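(* Let $\mathcal{A}$ be the set of abelian extensions $K$ of $\mathbb{Q}$ whose conductor is a power $p^r$ ($r\ge1$) of an odd prime $p$. There exists a function $\omega:\mathcal{A}\to\mathbb{R}$ such that: (i) for every $K\in\mathcal{A}$, $M(K)\le \omega(K)^{n_K}\sqrt{D_K}$; (ii) $\lim_{p_K\to\infty}\omega(K)=\frac{1}{2\sqrt3}$, where the limit is taken over the subfamily $\{K\in\mathcal{A}: r_K\ge2\}$, and also over each subfamily $\{K\in\mathcal{A}: r_K=1,\ [\mathbb{Q}(\zeta_{p_K}):K]=e_0\}$ for a fixed integer $e_0$; (iii) if $r_K\ge2$, then $\omega(K)\le 3^{-2/3}$.
   Context: For a number field $K$ with ring of integers $\mathcal{O}_K$, let $\mathrm{N}$ denote the absolute value of the norm $K\to\mathbb{Q}$, and $M(K)=\sup_{x\in K}\inf_{c\in\mathcal{O}_K}\mathrm{N}(x-c)$ is the Euclidean minimum. For $K\in\mathcal{A}$: $n_K=[K:\mathbb{Q}]$, $D_K$ is the absolute value of the discriminant, $p_K$ the prime dividing the conductor, $r_K$ the $p_K$-adic valuation of the conductor. For $\mathcal{D}\subset\mathcal{A}$ and $\psi:\mathcal{D}\to\mathbb{R}$, $\lim_{p_K\to\infty}\psi(K)=\psi_0$ means: for every $\epsilon>0$ there is $N$ such that for all $K\in\mathcal{D}$ with $p_K>N$, $|\psi(K)-\psi_0|<\epsilon$. *)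

(* Defs.v *)
From HB Require Import structures.
From mathcomp Require Import all_boot all_order all_algebra all_fingroup.
From mathcomp Require Import all_solvable all_field.
From mathcomp Require Import all_classical all_reals all_analysis.

Set Implicit Arguments.
Unset Strict Implicit.
Unset Printing Implicit Defensive.

Import Order.TTheory GRing.Theory Num.Theory.
Local Open Scope classical_set_scope.
Local Open Scope ring_scope.

Section NumberField.
Variable K : fieldExtType rat.

Definition mul_matrix (x : K) : 'M[rat]_(\dim {:K}) :=
  passmx.mxof (vbasis {:K}) (vbasis {:K}) (amull x).

Definition field_trace (x : K) : rat := \tr (mul_matrix x).

Definition abs_norm (x : K) : rat := `| \det (mul_matrix x) |.

Definition ring_of_integers : set K := [set x | integralOver (intr : int -> K) x].

(* A Q-basis of K whose Z-span is the ring of integers. *)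
Definition integral_basis (b : (\dim {:K}).-tuple K) : Prop :=
  basis_of {:K} b /\
  (forall x : K, ring_of_integers x <->
     exists a : 'I_(\dim {:K}) -> int, x = \sum_i tnth b i *~ a i).

Definition basis_disc (b : (\dim {:K}).-tuple K) : rat :=
  \det (\matrix_(i, j) field_trace (tnth b i * tnth b j)).

(* All integral bases give the same value; the default 0 is only there to make
   the definition total, since an integral basis always exists. *)
Definition abs_disc : rat :=
  xget 0 [set D | exists2 b, integral_basis b & D = `| basis_disc b |].

(* Valued in the extended reals, so that finiteness is not presupposed. *)
Definition euclidean_minimum (R : realType) : \bar R :=
  ereal_sup [set ereal_inf [set (ratr (abs_norm (x - c)))%:E
                               | c in ring_of_integers]
                | x in [set: K]].

End NumberField.

Definition is_cyclotomic_field (f : nat) (L : fieldExtType rat) : Prop :=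
  exists2 z : L, f.-primitive_root z & <<1; z>>%VS = {:L}%VS.

Definition embeds_in_cyclotomic (K : fieldExtType rat) (f : nat) : Prop :=
  exists2 L : fieldExtType rat, is_cyclotomic_field f L & inhabited 'AHom(K, L).

(* [Q(zeta_f) : K] = e, the field K being identified with its image under an
   embedding into Q(zeta_f). *)
Definition cyclotomic_degree_over (K : fieldExtType rat) (f e : nat) : Prop :=
  exists2 L : fieldExtType rat, is_cyclotomic_field f L &
    exists phi : 'AHom(K, L), (\dim_(limg phi) {:L})%N = e.

(* The least f > 0 such that K embeds in Q(zeta_f); it exists for abelian K by
   the Kronecker-Weber theorem, and the value is 0 when there is no such f. *)
Definition is_conductor (K : fieldExtType rat) (f : nat) : Prop :=
  [/\ (0 < f)%N, embeds_in_cyclotomic K f &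
      forall g, (0 < g)%N -> embeds_in_cyclotomic K g -> (f <= g)%N].

Definition conductor (K : fieldExtType rat) : nat :=
  xget 0%N [set f | is_conductor K f].

Definition abelian_ext (K : splittingFieldType rat) : Prop :=
  galois 1 {:K} /\ abelian ('Gal({:K} / 1))%g.

Record odd_prime_power_field := OddPrimePowerField {
  opp_field :> splittingFieldType rat;
  opp_abelian : abelian_ext opp_field;
  opp_conductor : exists p r : nat,
    [/\ prime p, odd p, (1 <= r)%N & conductor opp_field = (p ^ r)%N]
}.

Definition n_ (K : odd_prime_power_field) : nat := \dim {:K}.

Definition D_ (K : odd_prime_power_field) : rat := abs_disc K.

(* The conductor of K is a prime power, so that its least prime divisor is its
   only prime divisor. *)
Definition p_ (K : odd_prime_power_field) : nat := pdiv (conductor K).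

Definition r_ (K : odd_prime_power_field) : nat := logn (p_ K) (conductor K).

Definition lim_p_infty (R : realType) (D : odd_prime_power_field -> Prop)
    (psi : odd_prime_power_field -> R) (psi0 : R) : Prop :=
  forall eps : R, 0 < eps -> exists N : nat,
    forall K, D K -> (N < p_ K)%N -> `| psi K - psi0 | < eps.

(* Main.v *)
(** Let [q = p ^ r] be the conductor, [m = p ^ (r - 1)], [L = Q(z)] with [z] a
primitive [q]-th root of unity, [H = Gal(L / K)], [e = #|H|] and [n = [K : Q]].

Upper bound.  An element of [K] is a combination [\sum_a x_a z^a] over residues
[a] mod [q] with [H]-invariant rational coefficients.  For a suitable common
shift [t], rounding every [x_a - t] to the nearest integer leaves errors whose
squares sum to at most [q / 12] (average over [t]); adding a constant to all the
coefficients does not change the element, and the result is an [H]-invariant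
element of [Z[z]].  As [Tr_L |\sum_a g_a z^a|^2 <= q \sum_a g_a^2], the
arithmetic-geometric mean inequality gives
[M(K)^2 <= (q^2 / (12 e n))^n].

Discriminant.  Minimality of the conductor forces [p] not to divide [e], so [H]
acts freely on the nonzero residues mod [q] and mod [m].  Discarding an
[H]-equivariant set of representatives mod [m], the periods attached to the
remaining [H]-orbits form an integral basis of [K]; the determinant of its Gram
matrix for the trace form is [q ^ n / p ^ B] with [B = (m - 1) / e + 1], by
[det (1 - X Y) = det (1 - Y X)].

The two facts give (i) with
[omega(K)^2 = 1/12 * p/(p-1) * p ^ (B / n)], and (ii) and (iii) are estimates of
this expression, except for the cubic field of conductor 9 in (iii). *)

From HB Require Import structures.
From mathcomp Require Import all_boot all_order all_algebra all_fingroup.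
From mathcomp Require Import all_solvable all_field.
From mathcomp Require Import all_classical all_reals all_analysis.
From mathcomp Require Import ring lra zify.
Require Import Defs.

Set Implicit Arguments.
Unset Strict Implicit.
Unset Printing Implicit Defensive.

Import Order.TTheory GRing.Theory Num.Theory.
Local Open Scope ring_scope.

(** Coefficients on the powers of [z] are far from unique: a function of [a] that is constant on
    classes mod [m] represents 0, being a combination of full sums over [p]-th roots of unity. This
    freedom permits the shift in the rounding, and it is the obstacle to a basis: the redundant
    coefficients must be removed without losing invariance under [H]. Freeness makes an equivariant
    choice possible; it holds because an automorphism congruent to 1 mod [p] has [p]-power order.
    The determinant is taken for the Hermitian form [Tr (x * c y)], with [c] complex conjugation:
    distinct periods meet in it only through classes mod [m], and up to sign it still gives the
    discriminant. Integrality rests on the ring of integers of [L] being [Z[z]], a consequence of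
    the total ramification of [p]. The constant 1/12 is the mean square of a rounding error and
    [1 / (2 sqrt 3)] its root; the other factors of [omega(K)^2] tend to 1. The cubic field of
    conductor 9 has discriminant 81 and a refined rounding gives [M(K) <= 1]; solving
    [omega^3 * 9 = 1] yields [3^(-2/3)]. *)

(** * A determinant identity, and rounding with a common shift *)

(** Two block triangular factorisations of the matrix with blocks [1], [A], [B], [1]. The gain is in
    size: a Gram determinant of order [n] becomes that of a scalar matrix indexed by the blocks. *)
Lemma det_1B_mulmxC (R : comNzRingType) m n (A : 'M[R]_(m, n)) (B : 'M[R]_(n, m)) :
  \det (1%:M - A *m B) = \det (1%:M - B *m A).
Proof.
have E1 : block_mx 1%:M A B 1%:M =
    block_mx 1%:M 0 B 1%:M *m block_mx 1%:M A 0 (1%:M - B *m A).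
  by rewrite mulmx_block !mul1mx !mul0mx !mulmx1 !addr0 addrC subrK.
have E2 : block_mx 1%:M A B 1%:M =
    block_mx (1%:M - A *m B) A 0 1%:M *m block_mx 1%:M 0 B 1%:M.
  by rewrite mulmx_block !mul0mx !mulmx1 !mulmx0 !add0r mul1mx subrK.
have := congr1 determinant E1; rewrite {}E2 !det_mulmx !det_lblock !det_ublock.
by rewrite !det1 !mulr1 !mul1r.
Qed.

Lemma sum_sqr_centered_odd (M N : nat) :
  \sum_(s < N) (2 * s%:R + 1 - M%:R) ^+ 2 =
  N%:R * (4 * N%:R ^+ 2 - 1) / 3 - 2 * M%:R * N%:R ^+ 2 + M%:R ^+ 2 * N%:R :> rat.
Proof.
elim: N => [|N IH]; first by rewrite big_ord0; field.
by rewrite big_ord_recr /= {}IH -[N.+1]addn1 natrD; field.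
Qed.

(** The points are the midpoints of [M] equal parts of the unit interval, and the exact value is
    [M / 12 - 1 / (12 M)]; 1/12 is the variance of the uniform law. *)
Lemma sum_sqr_grid (M : nat) : (0 < M)%N ->
  \sum_(s < M) ((2 * s%:R + 1) / (2 * M%:R) - 1 / 2) ^+ 2 <= M%:R / 12 :> rat.
Proof.
move=> M_gt0; have M0 : M%:R != 0 :> rat by rewrite pnatr_eq0 -lt0n.
have -> : \sum_(s < M) ((2 * s%:R + 1) / (2 * M%:R) - 1 / 2) ^+ 2
    = (\sum_(s < M) (2 * s%:R + 1 - M%:R) ^+ 2) / (4 * M%:R ^+ 2) :> rat.
  by rewrite mulr_suml; apply: eq_bigr => s _; field.
rewrite sum_sqr_centered_odd -subr_ge0.
have -> : M%:R / 12 - (M%:R * (4 * M%:R ^+ 2 - 1) / 3 - 2 * M%:R * M%:R ^+ 2 +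
    M%:R ^+ 2 * M%:R) / (4 * M%:R ^+ 2) = (12 * M%:R)^-1 :> rat by field.
by rewrite invr_ge0 mulr_ge0 ?ler0n.
Qed.

Lemma common_denominator (I : finType) (x : I -> rat) :
  exists2 k : nat, (0 < k)%N & forall i, exists X : int, x i = X%:~R / k%:R.
Proof.
pose d i := `|denq (x i)|%N.
have d_gt0 i : (0 < d i)%N by rewrite absz_gt0 denq_eq0.
exists (\prod_i d i)%N; first by rewrite prodn_gt0.
move=> i; exists (numq (x i) * (\prod_(j | j != i) d j)%N%:Z).
rewrite [X in _ / X%:R](bigD1 i) //= natrM intrM.
have -> : (d i)%:R = (denq (x i))%:~R :> rat.
  by rewrite pmulrn gez0_abs ?denq_ge0.
set P := (\prod_(j | j != i) d j)%N; have P0 : P%:R != 0 :> rat.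
  by rewrite pnatr_eq0 -lt0n prodn_gt0.
have D0 : (denq (x i))%:~R != 0 :> rat by rewrite intr_eq0 denq_eq0.
by rewrite -{1}[x i]divq_num_den -[P%:~R]/(P%:R); field; rewrite P0 D0.
Qed.

(* Averaging the squared distance of [x i - t] to the integers over a full
   grid of shifts [t] gives at most 1/12 for each [i]. *)
Lemma exists_shift_rounding (I : finType) (P : {pred I}) (x : I -> rat) :
  exists (t : rat) (c : I -> int),
    (forall i j, x i = x j -> c i = c j) /\
    \sum_(i in P) (x i - (c i)%:~R - t) ^+ 2 <= #|P|%:R / 12.
Proof.
have [k k_gt0 Xk] := common_denominator x.
(* With [M = 2 k], the number 1/2 is the grid point [k / M], so rounding [x i - t j] to the nearest
   integer is the integer division of [X i + k - 1 - j] by [M]; the half-odd shifts exclude ties. *)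
have [M [M_gt0 MR]] : exists M : nat, (0 < M)%N /\ M%:R = 2 * k%:R :> rat.
  by exists (2 * k)%N; rewrite muln_gt0 k_gt0 natrM.
pose X i := numq (x i * M%:R).
have M0 : M%:R != 0 :> rat by rewrite pnatr_eq0 -lt0n.
have k0 : k%:R != 0 :> rat by rewrite pnatr_eq0 -lt0n.
have xE i : x i = (X i)%:~R / M%:R.
  have [Y xY] := Xk i; have XE : x i * M%:R = (2 * Y)%:~R.
    by rewrite xY MR intrM; field.
  by rewrite /X XE numq_int -XE mulfK.
pose c (j : 'I_M) i := divz (X i + k%:Z - 1 - j%:Z) M%:Z.
pose t (j : 'I_M) : rat := (2 * j%:R + 1) / (2 * M%:R).
have Mz0 : M%:Z != 0 by rewrite eqz_nat -lt0n.
have sM (i : I) (j : 'I_M) : (`|modz (X i + k%:Z - 1 - j%:Z) M%:Z| < M)%N.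
  by rewrite -ltz_nat gez0_abs ?modz_ge0 // ltz_pmod.
pose s i j := Ordinal (sM i j).
have s_inj i : injective (s i).
  move=> j1 j2 /(congr1 val) /= /(congr1 Posz).
  rewrite !gez0_abs ?modz_ge0 // => /eqP; rewrite eqz_mod_dvd => dv.
  have {}dv : (M%:Z %| j2%:Z - j1%:Z)%Z.
    by move: dv; congr (_ %| _)%Z; ring.
  apply/val_inj/esym/eqP; rewrite -eqz_nat.
  have := dv; rewrite -eqz_mod_dvd => /eqP.
  by rewrite !modz_small ?ltz_nat ?ltn_ord ?lez_nat //= => ->.
have xsE i j : x i - (c j i)%:~R - t j = (2 * (s i j)%:R + 1) / (2 * M%:R) - 1 / 2.
  have := divz_eq (X i + k%:Z - 1 - j%:Z) M%:Z; rewrite -/(c j i).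
  have -> : modz (X i + k%:Z - 1 - j%:Z) M%:Z = (s i j)%:Z.
    by rewrite /= gez0_abs ?modz_ge0.
  move: (s i j) => sij /(congr1 (fun u : int => u%:~R : rat)).
  rewrite !(rmorphD, rmorphM, rmorphB, rmorphN, rmorph1) /= -!pmulrn => E.
  rewrite xE /t.
  have -> : (X i)%:~R = (c j i)%:~R * M%:R + sij%:R - k%:R + 1 + (j : nat)%:R :> rat.
    by rewrite -E; ring.
  by rewrite MR; field.
have tot : \sum_j \sum_(i in P) (x i - (c j i)%:~R - t j) ^+ 2 <= M%:R * (#|P|%:R / 12).
  rewrite exchange_big /=.
  have -> : M%:R * (#|P|%:R / 12) = \sum_(i in P) (M%:R / 12) :> rat.
    by rewrite sumr_const -mulr_natl; ring.
  apply: ler_sum => i _.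
  rewrite (eq_bigr (fun j => ((2 * (s i j)%:R + 1) / (2 * M%:R) - 1 / 2) ^+ 2)); last first.
    by move=> j _; rewrite xsE.
  have := sum_sqr_grid M_gt0; rewrite (reindex_inj (@s_inj i)) /=; exact.
have [j hj] : exists j, \sum_(i in P) (x i - (c j i)%:~R - t j) ^+ 2 <= #|P|%:R / 12.
  apply/existsP; apply: contraLR tot => /existsPn h.
  rewrite -ltNge.
  have -> : M%:R * (#|P|%:R / 12) = \sum_(j < M) (#|P|%:R / 12) :> rat.
    by rewrite sumr_const card_ord mulr_natl.
  apply: ltr_sum; last by move=> j _; rewrite ltNge h.
  by apply/hasP; exists (Ordinal M_gt0); rewrite ?mem_index_enum.
(* The rounded value depends on [x i] alone, so [H]-invariant coefficients will be rounded to
   [H]-invariant integers. *)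
by exists (t j), (c j); split=> // i1 i2 xi; rewrite /c /X xi.
Qed.

(** * Cyclotomic polynomials and integrality over the rationals *)

Lemma cyclotomic_splitting_axiom (L : fieldExtType rat) (q : nat) (z : L) :
  q.-primitive_root z -> <<1; z>>%VS = {:L}%VS -> splitting_field_axiom L.
Proof.
move=> pz gz; exists ('X^q - 1); first by rewrite rpredB ?rpredX ?polyOverX ?rpred1.
exists [seq z ^+ i | i <- index_iota 0 q].
  by rewrite big_map (factor_Xn_sub_1 pz) eqpxx.
apply/eqP; rewrite eqEsubv subvf -gz /=.
have q_gt0 := prim_order_gt0 pz.
apply/FadjoinP; split; first exact: sub1v.
apply: seqv_sub_adjoin; apply/mapP.
have [q1|q1] := ltnP 1 q.
  by exists 1%N; rewrite ?mem_index_iota ?expr1.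
exists 0%N; rewrite ?mem_index_iota //.
have := prim_expr_order pz; have -> : q = 1%N by apply/eqP; rewrite eqn_leq q1.
by rewrite expr1 expr0.
Qed.

Lemma root_Cyclotomic_prim (F : fieldType) (n : nat) (z : F) :
  n.-primitive_root z -> root (map_poly intr 'Phi_n) z.
Proof.
move=> pz; have n_gt0 := prim_order_gt0 pz.
have := congr1 (map_poly (intr : int -> F)) (prod_Cyclotomic n_gt0).
rewrite rmorph_prod rmorphB /= map_polyXn rmorph1 => E.
have : root ('X^n - 1) z by rewrite /root !hornerE prim_expr_order ?subrr.
rewrite -E /root horner_prod prodf_seq_eq0 => /hasP[d] /=.
rewrite -dvdn_divisors // => dn rd.
have d_gt0 : (0 < d)%N by rewrite (dvdn_gt0 n_gt0).
suff : z ^+ d = 1.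
  move/eqP; rewrite -(prim_order_dvd pz) => nd.
  by have -> : n = d by apply/eqP; rewrite eqn_dvd nd.
have := congr1 (map_poly (intr : int -> F)) (prod_Cyclotomic d_gt0).
rewrite rmorph_prod rmorphB /= map_polyXn rmorph1 (big_rem d) /=; last first.
  by rewrite -dvdn_divisors.
move/(congr1 (fun f => f.[z])); rewrite hornerM (rootP rd) mul0r !hornerE.
by move/esym/eqP; rewrite subr_eq0 => /eqP.
Qed.

(** Irreducibility of the cyclotomic polynomial [P], known from its being the minimal polynomial of
    a complex root [w]. Either the gcd of [P] and [g] vanishes at [w], and [P] divides [g]; or the
    cofactor does, the gcd is constant, and a Bezout relation contradicts the common root [z]. *)
Lemma Cyclotomic_dvd_rat (F : fieldType) (f : {rmorphism rat -> F}) (n : nat) (z : F)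
    (g : {poly rat}) :
  n.-primitive_root z -> root (map_poly f g) z ->
  map_poly intr 'Phi_n %| g.
Proof.
move=> pz gz; have n_gt0 := prim_order_gt0 pz.
have [w pw] := C_prim_root_exists n_gt0.
pose P : {poly rat} := map_poly intr 'Phi_n.
have PC : map_poly ratr P = minCpoly w.
  rewrite (minCpoly_cyclotomic pw) -(Cintr_Cyclotomic pw) -map_poly_comp.
  by apply: eq_map_poly => x /=; rewrite ratr_int.
have Pdv h : root (map_poly (ratr : rat -> algC) h) w = (P %| h).
  have [P' [DP' _] dv] := minCpolyP w; rewrite dv.
  suff -> : P = P' by [].
  by apply: (map_poly_inj (ratr : {rmorphism rat -> algC})); rewrite PC DP'.
have Pz : root (map_poly f P) z.
  rewrite -map_poly_comp; have := root_Cyclotomic_prim pz.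
  by congr root; apply: eq_map_poly => x /=; rewrite rmorph_int.
have Pw : root (map_poly ratr P) w by rewrite Pdv.
pose d := gcdp P g.
have dvP : d %| P := dvdp_gcdl P g.
move: Pw; rewrite -(divpK dvP) rmorphM rootM !Pdv => /orP[Pd|Pd]; last first.
  by rewrite (dvdp_trans Pd) // dvdp_gcdr.
have P0 : P != 0 by apply/monic_neq0/monic_map/Cyclotomic_monic.
have cop : coprimep P g.
  rewrite /coprimep -/d.
  have d0 : d != 0 by apply: contraNneq P0 => d0; rewrite d0 dvd0p in dvP.
  have Pd0 : P %/ d != 0 by rewrite divpN0 // dvdp_leq.
  have := dvdp_leq Pd0 Pd; rewrite size_divp // => le.
  have sd : (0 < size d)%N by rewrite size_poly_gt0.
  have sP : (0 < size P)%N by rewrite size_poly_gt0.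
  move: le; rewrite leqNgt ltn_subrL sP andbT -eqn0Ngt.
  by case: (size d) sd => [|[|k]].
have /Bezout_eq1_coprimepP[[u v] /= /(congr1 (map_poly f))] := cop.
move/(congr1 (fun h => h.[z])).
rewrite rmorphD !rmorphM /= rmorph1 !hornerE (rootP Pz) (rootP gz) !mulr0 addr0.
by move/eqP; rewrite eq_sym oner_eq0.
Qed.

Lemma natr_numfield_eq0 (L : fieldExtType rat) (n : nat) : (n%:R == 0 :> L) = (n == 0)%N.
Proof. by rewrite -(rmorph_nat (in_alg L)) fmorph_eq0 pnatr_eq0. Qed.

Lemma intr_numfield_inj (L : fieldExtType rat) : injective (intr : int -> L).
Proof.
move=> a b; rewrite -!(rmorph_int (in_alg L)) => /fmorph_inj.
exact: intr_inj.
Qed.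

Lemma integral_rat_int (F : fieldExtType rat) (a : rat) :
  integralOver (intr : int -> F) a%:A -> exists k : int, a = k%:~R.
Proof.
case=> g mg rg; have {}rg : root (map_poly (intr : int -> rat) g) a.
  move: rg; rewrite -in_algE -(fmorph_root (in_alg F)) -map_poly_comp.
  by congr root; apply: eq_map_poly => x; rewrite /= -in_algE rmorph_int.
have ai : (ratr a : algC) \in Aint.
  apply: (@root_monic_Aint (map_poly intr g)).
  - rewrite -(fmorph_root (ratr : {rmorphism rat -> algC})) -map_poly_comp in rg.
    by move: rg; congr root; apply: eq_map_poly => x; rewrite /= ratr_int.
  - exact: monic_map.
  - by apply/polyOverP => i; rewrite coef_map /= intr_int.
have /intrP[k ak] := Cint_rat_Aint (Crat_rat a) ai.
exists k; apply: (fmorph_inj (ratr : {rmorphism rat -> algC})).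
by rewrite rmorph_int.
Qed.

Lemma integral_fmorph (F1 F2 : fieldType) (f : {rmorphism F1 -> F2}) x :
  integralOver (intr : int -> F2) (f x) <-> integralOver (intr : int -> F1) x.
Proof.
split=> -[g mg rg]; exists g => //; move: rg.
  rewrite -(fmorph_root f) -map_poly_comp; congr root.
  by apply: eq_map_poly => k /=; rewrite rmorph_int.
rewrite -[in X in _ -> X](eq_map_poly (fun k => rmorph_int f k)).
by rewrite (map_poly_comp f intr) fmorph_root.
Qed.

Lemma integral_exp (F : fieldType) (x : F) n :
  integralOver (intr : int -> F) x -> integralOver (intr : int -> F) (x ^+ n).
Proof.
move=> ix; elim: n => [|n IH]; first exact: integral1.
by rewrite exprS; apply: integral_mul.
Qed.

Lemma integral_sum (F : fieldType) (I : Type) (s : seq I) (P : pred I) (f : I -> F) :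
  (forall i, P i -> integralOver (intr : int -> F) (f i)) ->
  integralOver (intr : int -> F) (\sum_(i <- s | P i) f i).
Proof.
move=> fi; elim/big_rec: _ => [|i x Pi ix]; first exact: mxpoly.integral0.
by apply: integral_add; first exact: fi.
Qed.

Section CastEnum.

Variables (T : finType) (A : {set T}) (n : nat) (cA : #|A| = n).

(** Matrices are indexed by ['I_(\dim {:K})], whereas the automorphisms of [K] and the residues
    indexing its periods are only sets of that cardinal. *)
Definition cast_enum (j : 'I_n) : T := enum_val (cast_ord (esym cA) j).

Lemma big_cast_enum (V : Type) (idx : V) (op : Monoid.com_law idx) (F : T -> V) :
  \big[op/idx]_(j < n) F (cast_enum j) = \big[op/idx]_(t in A) F t.
Proof.
rewrite [RHS]big_enum_val /= (reindex (cast_ord (esym cA))) //.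
by apply: onW_bij; exists (cast_ord cA) => j; rewrite ?cast_ordKV ?cast_ordK.
Qed.

Lemma cast_enum_inj : injective cast_enum.
Proof. by move=> i j /enum_val_inj/cast_ord_inj. Qed.

Lemma mem_cast_enum j : cast_enum j \in A.
Proof. exact: enum_valP. Qed.

End CastEnum.

(** * Number fields embedded in a Galois extension of the rationals *)

Section EmbeddedField.

Variable L : splittingFieldType rat.
Local Notation G := ('Gal({:L} / 1))%g.

Lemma galois_rat_full : galois 1 {:L}.
Proof.
rewrite /galois sub1v normalFieldf andbT /=.
apply/separableP => x _; apply: pcharf0_separable => n.
by rewrite !inE /= natr_numfield_eq0; case: n => //= n; rewrite andbF.
Qed.

Lemma mem_gal_full (s : gal_of {:L}) : s \in G.
Proof. by rewrite gal_kHom ?sub1v // k1AHom. Qed.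

Variables (K : fieldExtType rat) (phi : 'AHom(K, L)).
Local Notation K' := (phi @: {:K})%AS.
Local Notation GK := ('Gal(K' / 1))%g.
Local Notation n := (\dim {:K}).
Hypothesis galK : galois 1 K'.

Lemma dim_embedded : \dim K' = n.
Proof. by rewrite limg_dim_eq // (eqP (AHom_lker0 phi)) capv0. Qed.

Lemma card_gal_embedded : #|GK| = n.
Proof. by rewrite -(galois_dim galK) dimv1 divn1 dim_embedded. Qed.

Lemma mem_embedded x : phi x \in K'.
Proof. by rewrite memv_img ?memvf. Qed.

Definition conj_enum : 'I_n -> gal_of K' := cast_enum card_gal_embedded.

Definition conj_mx (b : n.-tuple K) : 'M[L]_n :=
  \matrix_(i, j) conj_enum j (phi (tnth b i)).

Lemma mul_matrix_vbasis x i :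
  x * tnth (vbasis {:K}) i = \sum_k mul_matrix x i k *: tnth (vbasis {:K}) k.
Proof.
rewrite {1}(coord_vbasis (memvf (x * tnth (vbasis {:K}) i))).
apply: eq_bigr => k _; rewrite -tnth_nth; congr (_ *: _).
rewrite /mul_matrix /passmx.mxof mxE /= !mxE /passmx.vecof lfunE /=.
congr (coord _ _ (_ * _)); rewrite (bigD1 i) //= mxE !eqxx /= scale1r -tnth_nth.
by rewrite big1 ?addr0 // => j ji; rewrite mxE (negPf ji) andbF scale0r.
Qed.

(** The conjugates diagonalise all multiplication matrices at once; this turns the matrix
    definitions of trace and norm into Galois sums and products. *)
Lemma conj_mx_eigen x :
  map_mx (in_alg L) (mul_matrix x) *m conj_mx (vbasis {:K}) =
  conj_mx (vbasis {:K}) *m diag_mx (\row_j conj_enum j (phi x)).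
Proof.
apply/matrixP => i j; rewrite mul_mx_diag !mxE mulrC -rmorphM -rmorphM /=.
rewrite mul_matrix_vbasis !linear_sum /=; apply: eq_bigr => k _.
by rewrite !mxE !linearZ /= mulr_algl.
Qed.

(** Independence of automorphisms: a kernel vector would be a linear relation between them on a
    basis, hence on all of [K]. *)
Lemma conj_mx_det_neq0 : \det (conj_mx (vbasis {:K})) != 0.
Proof.
rewrite -det_tr; apply/negP => /det0P[v v0 vP].
pose c (t : gal_of K') := \sum_j v 0 j *+ (conj_enum j == t).
have cE (F : gal_of K' -> L) : \sum_(t in GK) c t * F t = \sum_j v 0 j * F (conj_enum j).
  rewrite (eq_bigr (fun t => \sum_j (v 0 j *+ (conj_enum j == t)) * F t)); last first.
    by move=> t _; rewrite mulr_suml.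
  rewrite exchange_big /=; apply: eq_bigr => j _.
  rewrite (bigD1 (conj_enum j)) ?mem_cast_enum //= eqxx mulr1n big1 ?addr0 //.
  by move=> t /andP[_]; rewrite eq_sym => /negPf->; rewrite mulr0n mul0r.
have c0 t : t \in GK -> c t = 0.
  move=> tG; apply: (@gal_independent _ _ _ [in GK] c _ t tG) => a Ka.
  have /memv_imgP[y _ ->] := Ka.
  rewrite cE [y](coord_vbasis (memvf y)) (eq_bigr (fun j =>
    \sum_i coord (vbasis {:K}) i y *: (v 0 j * conj_enum j (phi (vbasis {:K})`_i)))).
    rewrite exchange_big /= big1 // => i _; rewrite -scaler_sumr.
    have /matrixP/(_ 0 i) := vP; rewrite !mxE => E.
    rewrite (eq_bigr (fun j => v 0 j * (conj_mx (vbasis {:K}))^T j i)) ?E ?scaler0 //.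
    by move=> j _; rewrite !mxE (tnth_nth 0).
  move=> j _; rewrite !linear_sum mulr_sumr; apply: eq_bigr => i _.
  by rewrite !linearZ /= scalerAr.
case/negP: v0; apply/eqP/rowP => j; rewrite mxE.
rewrite -[RHS](c0 (conj_enum j)) ?mem_cast_enum // /c (bigD1 j) //= eqxx mulr1n.
rewrite big1 ?addr0 // => k kj.
by rewrite (inj_eq (cast_enum_inj (cA := card_gal_embedded))) (negPf kj).
Qed.

Lemma field_trace_gal x : (field_trace x)%:A = galTrace 1 K' (phi x).
Proof.
have P_unit : conj_mx (vbasis {:K}) \in unitmx.
  by rewrite unitmxE unitfE conj_mx_det_neq0.
have /(canRL (mulmxK P_unit)) := conj_mx_eigen x.
move/(congr1 mxtrace); rewrite trace_map_mx mxtrace_mulC mulmxA mulVmx // mul1mx.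
rewrite mxtrace_diag /galTrace -(big_cast_enum card_gal_embedded _ (fun t => t (phi x))).
by move=> E; apply: etrans E _; apply: eq_bigr => j _; rewrite mxE.
Qed.

Lemma field_norm_gal x : (\det (mul_matrix x))%:A = galNorm 1 K' (phi x).
Proof.
have := congr1 determinant (conj_mx_eigen x).
rewrite !det_mulmx det_diag mulrC => /(mulfI conj_mx_det_neq0).
rewrite det_map_mx /galNorm -(big_cast_enum card_gal_embedded _ (fun t => t (phi x))) /= => ->.
by apply: eq_bigr => j _; rewrite mxE.
Qed.

Lemma basis_disc_conj_mx b : (basis_disc b)%:A = \det (conj_mx b) ^+ 2.
Proof.
rewrite expr2 -{2}(det_tr (conj_mx b)) -det_mulmx -in_algE -det_map_mx.
congr (\det _); apply/matrixP => i j; rewrite !mxE; apply: etrans (field_trace_gal _) _.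
rewrite rmorphM /=.
rewrite /galTrace -(big_cast_enum card_gal_embedded _ (fun t => t (phi (tnth b i) * phi (tnth b j)))).
by apply: eq_bigr => k _; rewrite !mxE rmorphM.
Qed.

Lemma conj_mx_change (b b' : n.-tuple K) (u : 'I_n -> 'I_n -> int) :
  (forall i, tnth b' i = \sum_j tnth b j *~ u i j) ->
  \det (conj_mx b') = (\det (\matrix_(i, j) u i j))%:~R * \det (conj_mx b).
Proof.
move=> bu; rewrite -det_map_mx -det_mulmx; congr (\det _).
apply/matrixP => i j; rewrite !mxE bu !rmorph_sum /=; apply: eq_bigr => k _.
by rewrite !mxE !rmorphMz /= mulrzl.
Qed.

(** [abs_disc] takes the value at an unspecified integral basis. Two such bases are related by
    integer matrices, with determinants [d] and [d'], and cancelling the nonzero discriminant leaves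
    [(d' * d) ^ 2 = 1]. *)
Lemma basis_disc_unique (b b' : n.-tuple K) : integral_basis b -> integral_basis b' ->
  basis_disc b != 0 -> `|basis_disc b'| = `|basis_disc b|.
Proof.
have change (c c' : n.-tuple K) : integral_basis c -> integral_basis c' ->
    exists d : int, basis_disc c' = d%:~R ^+ 2 * basis_disc c.
  move=> [_ cP] [_ cP'].
  have /fin_all_exists[u cu] : forall i, exists u : 'I_n -> int,
      tnth c' i = \sum_j tnth c j *~ u j.
    move=> i; apply/cP/cP'; exists (fun j => (j == i)%:Z).
    rewrite (bigD1 i) //= eqxx big1 ?addr0 ?mulr1z // => j /negPf->.
    by rewrite mulr0z.
  exists (\det (\matrix_(i, j) u i j)); apply: (fmorph_inj (in_alg L)).
  rewrite rmorphM rmorphXn rmorph_int /= !basis_disc_conj_mx.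
  by rewrite (conj_mx_change cu) exprMn.
move=> ib ib' b0; have [d bd] := change _ _ ib ib'; have [d' bd'] := change _ _ ib' ib.
rewrite bd normrM.
have /eqP : (d' * d) ^+ 2 = 1.
  apply/eqP; rewrite -(eqr_int rat) rmorphXn rmorphM /= exprMn; apply/eqP.
  by apply: (mulIf b0); rewrite -mulrA -bd -bd' mul1r.
rewrite sqrf_eq1 => dd; have : `|d| = 1.
  have : (`|d'| * `|d|)%N = 1%N by rewrite -abszM; case/orP: dd => /eqP->.
  by move/eqP; rewrite muln_eq1 => /andP[_ /eqP d1]; rewrite -abszE d1.
by move=> d1; rewrite normrX -intr_norm d1 expr1n mul1r.
Qed.

Lemma gal_extension (t : gal_of K') : t \in GK ->
  exists2 s : gal_of {:L}, s \in G & {in K', t =1 s}.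
Proof.
rewrite gal_kHom ?sub1v // => tK.
have le : (1 <= K' <= {:L})%VS by rewrite sub1v subvf.
by have [s sG st] := kHom_to_gal le (normalFieldf 1%AS) tK; exists s.
Qed.

(** Sum [s (t w)] over [s] in [G] and [t] in [GK]. The inner trace is rational, which gives [#|G|]
    times it; each [t] extends to [L], where the full trace is invariant, which gives [#|GK|] times
    the full trace. *)
Lemma trace_tower (w : L) : w \in K' ->
  galTrace 1 {:L} w = (\dim_K' {:L})%:R * galTrace 1 K' w.
Proof.
move=> Kw; pose T := galTrace 1 K' w.
have T1 : T \in 1%VS by rewrite mem_galTrace.
have E1 : \sum_(s in G) s T = #|G|%:R * T.
  rewrite (eq_bigr (fun=> T)) ?sumr_const ?mulr_natl // => s sG.
  exact: (fixed_gal (sub1v _) sG T1).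
have : \sum_(s in G) s T = #|GK|%:R * galTrace 1 {:L} w.
  rewrite /T /galTrace (eq_bigr (fun s : gal_of {:L} => \sum_(t in GK) s (t w))); last first.
    by move=> s _; rewrite rmorph_sum.
  rewrite exchange_big /= mulr_natl -sumr_const; apply: eq_bigr => t tG.
  have [s sG st] := gal_extension tG.
  by rewrite st // -/(galTrace 1 {:L} (s w)) galTrace_gal ?memvf.
have dimL : \dim {:L} = (n * \dim_K' {:L})%N.
  rewrite mulnC; apply: etrans (@dim_sup_field _ _ K' {:L}%AS (subvf _)) _.
  by congr (_ * _)%N; apply: dim_embedded.
have n0 : n%:R != 0 :> L by rewrite natr_numfield_eq0 -lt0n adim_gt0.
rewrite {}E1 -(galois_dim galois_rat_full) card_gal_embedded dimv1 divn1 [X in X%:R * T]dimL.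
by rewrite natrM -mulrA => /(mulfI n0) <-.
Qed.

Variable c : gal_of {:L}.
Hypothesis cC : forall (s : gal_of {:L}) y, c (s y) = s (c y).
Hypothesis cK : forall y, y \in K' -> c y \in K'.

Lemma conj_commute (t : gal_of K') y : t \in GK -> y \in K' -> c (t y) = t (c y).
Proof.
move=> tG Ky; have [s sG st] := gal_extension tG.
by rewrite !st ?cK // cC.
Qed.

(** With [P] the matrix of conjugates, [d = \det P * c (\det P)]. As [c] fixes the rational number
    [\det P ^ 2], which is the discriminant, [d ^ 2] is the square of the discriminant. *)
Lemma basis_disc_gram (b : n.-tuple K) (d : rat) :
  \det (\matrix_(i, j) galTrace 1 K' (phi (tnth b i) * c (phi (tnth b j)))) = d%:A ->
  `|basis_disc b| = `|d|.
Proof.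
move=> dE; have gramE : d%:A = \det (conj_mx b) * c (\det (conj_mx b)).
  rewrite -dE -det_map_mx -(det_tr (map_mx _ _)) -det_mulmx; congr (\det _).
  apply/matrixP => i j; rewrite !mxE /galTrace.
  rewrite -(big_cast_enum card_gal_embedded _ (fun t => t (phi (tnth b i) * c (phi (tnth b j))))).
  apply: eq_bigr => k _; rewrite !mxE rmorphM /=.
  by rewrite conj_commute ?mem_cast_enum ?mem_embedded.
have cd : c (\det (conj_mx b)) ^+ 2 = \det (conj_mx b) ^+ 2.
  by rewrite -rmorphXn -basis_disc_conj_mx /= rmorph_alg.
apply/eqP; rewrite -(@eqrXn2 _ 2) ?normr_ge0 // -!normrX; apply/eqP.
congr `|_|; apply: (fmorph_inj (in_alg L)).
by rewrite !rmorphXn /= basis_disc_conj_mx gramE [RHS]exprMn cd -expr2.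
Qed.

Variable iota : {rmorphism L -> algC}.
Hypothesis iotaC : forall y, iota (c y) = (iota y)^*.

(** As [c] commutes with every automorphism, the conjugates of [phi x * c (phi x)] are, through
    [iota], the squared absolute values of the conjugates of [x]. Their sum is [B], their product
    the squared norm. *)
Lemma abs_norm_AGM (x : K) (B B' : rat) :
  galTrace 1 K' (phi x * c (phi x)) = B%:A -> B <= B' ->
  abs_norm x ^+ 2 <= (B' / n%:R) ^+ n.
Proof.
move=> BE leB.
have BS : ratr B = \sum_(t in GK) `|iota (t (phi x))| ^+ 2 :> algC.
  have -> : ratr B = iota B%:A by rewrite alg_num_field fmorph_rat.
  rewrite -BE /galTrace rmorph_sum; apply: eq_bigr => t tG.
  by rewrite normCK -iotaC conj_commute ?mem_embedded // -!rmorphM.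
have B_ge0 : 0 <= B.
  by rewrite -(ler_rat algC) rmorph0 BS sumr_ge0 // => t _; rewrite exprn_ge0.
apply: (@le_trans _ _ ((B / n%:R) ^+ n)); last first.
  by rewrite lerXn2r ?ler_wpM2r ?nnegrE ?mulr_ge0 ?invr_ge0 ?ler0n // (le_trans B_ge0).
rewrite -(ler_rat algC) !rmorphXn fmorph_div /= ratr_nat.
have -> : ratr (abs_norm x) ^+ 2 = \prod_(t in GK) `|iota (t (phi x))| ^+ 2 :> algC.
  rewrite prodrXl -normr_prod -rmorph_prod -/(galNorm 1 K' (phi x)) -field_norm_gal.
  by rewrite alg_num_field fmorph_rat /abs_norm ratr_norm.
rewrite BS -card_gal_embedded; apply: (leif_AGM _).1 => t _.
by rewrite exprn_ge0.
Qed.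

End EmbeddedField.

(** * The cyclotomic field of prime power conductor *)

Section CyclotomicField.

Variables (L : splittingFieldType rat) (z : L) (p r : nat).
Hypotheses (p_pr : prime p) (r_gt0 : (0 < r)%N).
Local Notation q := (p ^ r)%N.
Local Notation m := (p ^ r.-1)%N.
Hypotheses (pz : q.-primitive_root z) (gz : <<1; z>>%VS = {:L}%VS).
Local Notation G := ('Gal({:L} / 1))%g.

Lemma ppow_gt1 : (1 < q)%N.
Proof. by rewrite -(exp1n r) ltn_exp2r ?prime_gt1. Qed.

Lemma ppowE : q = (p * m)%N.
Proof. by rewrite -expnS prednK. Qed.

Lemma ppow_pred_gt0 : (0 < m)%N.
Proof. by rewrite expn_gt0 prime_gt0. Qed.

Lemma totient_ppow : (totient q + m = q)%N.
Proof.
rewrite totient_pfactor // [in RHS]ppowE addnC -mulSn prednK //.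
exact: prime_gt0.
Qed.

Lemma Zp_ppow : (Zp_trunc q).+2 = q.
Proof. by rewrite Zp_cast // ppow_gt1. Qed.

Lemma card_Zq : #|'Z_q| = q.
Proof. by rewrite card_ord Zp_ppow. Qed.

Definition zroot (a : 'Z_q) : L := z ^+ a.

Lemma zroot_nat k : zroot k%:R = z ^+ k.
Proof.
by rewrite /zroot val_Zp_nat ?ppow_gt1 // (prim_expr_mod pz).
Qed.

Lemma zroot1 : zroot 1 = z. Proof. by rewrite -[RHS]expr1 -zroot_nat. Qed.

Lemma zroot0 : zroot 0 = 1. Proof. exact: expr0. Qed.

Lemma zrootD a b : zroot (a + b) = zroot a * zroot b.
Proof.
by rewrite -[a]natr_Zp -[b]natr_Zp -natrD !zroot_nat exprD.
Qed.

Lemma zrootM a b : zroot (a * b) = zroot a ^+ b.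
Proof.
by rewrite -{1}[a]natr_Zp -{1}[b]natr_Zp -natrM zroot_nat exprM.
Qed.

Lemma zroot_natM k b : zroot (k%:R * b) = zroot b ^+ k.
Proof. by rewrite -{1}[b]natr_Zp -natrM zroot_nat mulnC exprM. Qed.

Lemma zroot_eq1 a : (zroot a == 1) = (a == 0).
Proof.
rewrite /zroot -(prim_order_dvd pz) -val_eqE /=.
apply/idP/eqP => [/dvdn_leq|->]; last by rewrite dvdn0.
have := ltn_ord a; rewrite {2}Zp_ppow; case: (val a) => // k lt /(_ isT).
by rewrite leqNgt lt.
Qed.

Lemma zroot_neq0 a : zroot a != 0.
Proof. by rewrite expf_neq0 // (prim_root_eq0 pz) -lt0n expn_gt0 prime_gt0. Qed.

Lemma zrootN a : zroot (- a) = (zroot a)^-1.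
Proof.
apply: (mulfI (zroot_neq0 a)).
by rewrite -zrootD subrr zroot0 divff ?zroot_neq0.
Qed.

Lemma zroot_inj : injective zroot.
Proof.
move=> a b ab; apply/eqP; rewrite -subr_eq0 -zroot_eq1 zrootD zrootN ab.
by rewrite divff ?zroot_neq0.
Qed.

Lemma minPoly_cyclotomic : minPoly 1 z = map_poly intr 'Phi_q.
Proof.
have PhiL : map_poly intr 'Phi_q = map_poly (in_alg L) (map_poly intr 'Phi_q).
  by rewrite -map_poly_comp; apply: eq_map_poly => x /=; rewrite -in_algE rmorph_int.
have [g Dg] := polyOver1P (minPolyOver 1 z).
have rg : root (map_poly (in_alg L) g) z by rewrite -Dg root_minPoly.
have dv1 := Cyclotomic_dvd_rat pz rg.
have dv2 : minPoly 1 z %| map_poly intr 'Phi_q.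
  apply: minPoly_dvdp; first by rewrite PhiL alg_polyOver.
  exact: root_Cyclotomic_prim.
apply/eqP; rewrite -eqp_monic ?monic_minPoly //; last first.
  exact/monic_map/Cyclotomic_monic.
by rewrite /eqp dv2 /= Dg PhiL dvdp_map.
Qed.

Lemma dim_cyclotomic : \dim {:L} = totient q.
Proof.
have := size_minPoly 1 z; rewrite minPoly_cyclotomic -gz dim_Fadjoin.
rewrite size_map_inj_poly ?size_Cyclotomic //; last exact: intr_numfield_inj.
by rewrite dimv1 muln1 => -[].
Qed.

(** * The cyclotomic character *)

Lemma gal_zroot_ex (s : gal_of {:L}) : exists a, s z == zroot a.
Proof.
have : s z ^+ q = 1 by rewrite -rmorphXn (prim_expr_order pz) rmorph1.
by move/(prim_rootP pz) => [i ->]; exists (i : nat)%:R; rewrite zroot_nat.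
Qed.

Definition cycl_char (s : gal_of {:L}) : 'Z_q := xchoose (gal_zroot_ex s).
Local Notation chi := cycl_char.

Lemma gal_zroot (s : gal_of {:L}) a : s (zroot a) = zroot (chi s * a).
Proof.
by rewrite {1}/zroot rmorphXn /= (eqP (xchooseP (gal_zroot_ex s))) zrootM.
Qed.

Lemma gal_eq_zroot (s t : gal_of {:L}) : s z = t z -> s = t.
Proof.
move=> st; apply/eqP/gal_eqP => y _.
have : y \in <<1; z>>%VS by rewrite gz memvf.
case/Fadjoin1_polyP => g ->.
rewrite -!horner_map /= st; congr (_.[_]).
rewrite -!map_poly_comp; apply: eq_map_poly => x /=.
by rewrite -in_algE !rmorph_alg.
Qed.

Lemma cycl_char_inj : injective chi.
Proof.
move=> s t st; apply: gal_eq_zroot.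
by rewrite -[z]expr1 -(zroot_nat 1) !gal_zroot st.
Qed.

Lemma cycl_charM s t : chi (s * t)%g = chi s * chi t.
Proof.
apply: zroot_inj; rewrite -[chi (s * t)%g]mulr1 -gal_zroot galM ?memvf //.
by rewrite !gal_zroot mulr1 mulrC.
Qed.

Lemma cycl_char1 : chi 1%g = 1.
Proof. by apply: zroot_inj; rewrite -[chi 1%g]mulr1 -gal_zroot gal_id. Qed.

Lemma cycl_char_unit s : chi s \is a GRing.unit.
Proof.
apply/unitrP; exists (chi s^-1%g).
by rewrite -!cycl_charM mulVg mulgV cycl_char1.
Qed.

Lemma cycl_char_surj u : u \is a GRing.unit -> exists s, chi s = u.
Proof.
move=> Uu; have pzu : q.-primitive_root (zroot u).
  rewrite /zroot (prim_root_exp_coprime _ pz) coprime_sym.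
  by rewrite -unitZpE ?ppow_gt1 // natr_Zp.
have [|s _ sz] := @normalField_root_minPoly _ _ 1%AS {:L}%AS z (zroot u)
  (sub1v _) (normalFieldf _) (memvf _).
  by rewrite minPoly_cyclotomic root_Cyclotomic_prim.
exists s; apply: zroot_inj; rewrite -sz -[chi s]mulr1 -gal_zroot.
by rewrite -[1](_ : 1%:R = _) // zroot_nat expr1.
Qed.

Lemma sum_cycl_char (V : zmodType) (F : 'Z_q -> V) :
  \sum_(s in G) F (chi s) = \sum_(u : 'Z_q | u \is a GRing.unit) F u.
Proof.
rewrite -(big_imset F (in2W cycl_char_inj)) /=; apply: eq_bigl => u.
apply/imsetP/idP => [[s _ ->]|/cycl_char_surj[s <-]]; first exact: cycl_char_unit.
by exists s; rewrite ?mem_gal_full.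
Qed.

Lemma unit_ppowE (u : 'Z_q) : (u \is a GRing.unit) = ~~ (p %| u)%N.
Proof.
rewrite -{1}[u]natr_Zp unitZpE ?ppow_gt1 // coprime_pexpl //.
by rewrite prime_coprime.
Qed.

Lemma card_galois : #|G| = totient q.
Proof.
by rewrite -(galois_dim (galois_rat_full L)) dimv1 divn1 dim_cyclotomic.
Qed.

Lemma card_nonunit : #|[pred u : 'Z_q | u \isn't a GRing.unit]| = m.
Proof.
have := sum_cycl_char (fun=> 1%:Z); rewrite !sumr_const card_galois => /eqP.
rewrite !pmulrn !intz eqz_nat => /eqP E.
have := etrans (cardC [pred u : 'Z_q | u \is a GRing.unit]) card_Zq.
rewrite -[in RHS]totient_ppow.
rewrite [#|[pred u : 'Z_q | u \is a GRing.unit]|](_ : _ = totient q); last first.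
  by rewrite E; apply: eq_card => u; rewrite inE.
by move/addnI => <-; apply: eq_card => u; rewrite !inE.
Qed.

(** * Traces of roots of unity *)

Lemma sum_zroot (a : 'Z_q) :
  \sum_(u : 'Z_q) zroot (u * a) = (q * (a == 0))%:R.
Proof.
have [->|a0] := eqVneq a 0.
  rewrite (eq_bigr (fun=> 1)) => [|u _]; last by rewrite mulr0 zroot0.
  by rewrite sumr_const card_ord Zp_ppow muln1.
rewrite muln0; set S := \sum_u _.
have : S = zroot a * S.
  rewrite {1}/S (reindex_inj (addrI 1)) /= mulr_sumr; apply: eq_bigr => u _.
  by rewrite mulrDl mul1r zrootD.
move/eqP; rewrite -subr_eq0 -{1}[S]mul1r -mulrBl mulf_eq0 subr_eq0 eq_sym.
by rewrite zroot_eq1 (negPf a0) /= => /eqP.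
Qed.

(** Translation by [p] permutes the nonunits and multiplies the sum by [zroot (p%:R * a)]. Here and
    below, [p%:R * a = p%:R * b] is the way to say that [a] and [b] agree mod [p ^ r.-1]. *)
Lemma sum_zroot_nonunit (a : 'Z_q) :
  \sum_(u : 'Z_q | u \isn't a GRing.unit) zroot (u * a) = (m * (p%:R * a == 0))%:R.
Proof.
have [pa|pa] := eqVneq (p%:R * a) 0.
  rewrite (eq_bigr (fun=> 1)) => [|u].
    by rewrite sumr_const -card_nonunit muln1; congr (_ *+ _); apply: eq_card.
  rewrite unit_ppowE negbK => /dvdnP[k uk].
  by rewrite -[u]natr_Zp uk natrM -mulrA pa mulr0 zroot0.
rewrite muln0; set S := \sum_(u | _) _.
have : S = zroot (p%:R * a) * S.
  rewrite {1}/S (reindex_inj (addrI p%:R)) /= mulr_sumr.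
  apply: eq_big => [u|u _]; last by rewrite mulrDl zrootD.
  congr (~~ _); rewrite !unit_ppowE -{1}[u]natr_Zp -natrD val_Zp_nat ?ppow_gt1 //.
  by rewrite /dvdn modn_dvdm ?ppowE ?dvdn_mulr // modnDl.
move/eqP; rewrite -subr_eq0 -{1}[S]mul1r -mulrBl mulf_eq0 subr_eq0 eq_sym.
by rewrite zroot_eq1 (negPf pa) /= => /eqP.
Qed.

Local Notation Tr := (galTrace 1 {:L}).

Lemma trace_zroot a :
  Tr (zroot a) = (q * (a == 0))%:R - (m * (p%:R * a == 0))%:R.
Proof.
rewrite /galTrace (eq_bigr (fun s => zroot (chi s * a))) => [|s _]; last first.
  by rewrite gal_zroot.
rewrite (sum_cycl_char (fun u => zroot (u * a))) -sum_zroot -sum_zroot_nonunit.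
by rewrite [in RHS](bigID (fun u : 'Z_q => u \is a GRing.unit)) /= addrK.
Qed.

(** Fourier inversion: in the sum over [a], the conjugate [s y] gets a factor that vanishes unless
    [chi s = 1]. It provides rational coefficients for any [y], and places [q * y] in [Z[z]] for
    integral [y]. *)
Lemma trace_inversion (y : L) :
  \sum_(a : 'Z_q) Tr (y * zroot (- a)) * zroot a = q%:R * y.
Proof.
rewrite (eq_bigr (fun a => \sum_(s in G) s y * zroot (a * (1 - chi s)))); last first.
  move=> a _; rewrite mulr_suml; apply: eq_bigr => s _.
  by rewrite rmorphM /= gal_zroot -mulrA -zrootD mulrBr mulr1 mulrN addrC (mulrC a).
rewrite exchange_big /= (bigD1 1%g) ?group1 //= [X in _ + X]big1 => [|s].
  rewrite cycl_char1 subrr gal_id addr0 -mulr_sumr.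
  by rewrite sum_zroot eqxx muln1 mulrC.
case/andP=> _ s1; rewrite -mulr_sumr sum_zroot subr_eq0 eq_sym -cycl_char1 (inj_eq cycl_char_inj).
by rewrite (negPf s1) muln0 mulr0.
Qed.

(** * The ring of integers of the cyclotomic field *)

Local Notation integral := (integralOver (intr : int -> L)).

Lemma integral_zroot a : integral (zroot a).
Proof.
apply: integral_exp; exists ('X^q - 1).
  by apply: monicXnsubC; rewrite expn_gt0 prime_gt0.
rewrite rmorphB /= map_polyXn rmorph1 /root !hornerE.
by rewrite (prim_expr_order pz) subrr.
Qed.

Lemma trace_int y : integral y -> exists k : int, Tr y = k%:~R.
Proof.
move=> iy; have /vlineP[a Ta] := mem_galTrace (galois_rat_full L) (memvf y).
have : integral (Tr y).
  by apply: integral_sum => s _; apply/integral_fmorph.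
rewrite Ta => /integral_rat_int[k ->]; exists k.
by rewrite -in_algE rmorph_int.
Qed.

Definition zspan (y : L) := exists g : {poly int}, y = (map_poly intr g).[z].

Lemma zspanD x y : zspan x -> zspan y -> zspan (x + y).
Proof. by move=> [g ->] [h ->]; exists (g + h); rewrite rmorphD hornerD. Qed.

Lemma zspanM x y : zspan x -> zspan y -> zspan (x * y).
Proof. by move=> [g ->] [h ->]; exists (g * h); rewrite rmorphM hornerM. Qed.

Lemma zspan_int (k : int) : zspan k%:~R.
Proof. by exists k%:P; rewrite map_polyC hornerC. Qed.

Lemma zspan1 : zspan 1. Proof. exact: (zspan_int 1). Qed.

Lemma zspan_gen : zspan z.
Proof. by exists 'X; rewrite map_polyX hornerX. Qed.

Lemma zspanX x n : zspan x -> zspan (x ^+ n).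
Proof.
move=> sx; elim: n => [|n IH]; first exact: zspan1.
by rewrite exprS; apply: zspanM.
Qed.

Lemma zspan_zroot a : zspan (zroot a).
Proof. exact/zspanX/zspan_gen. Qed.

Lemma zspan_sum (I : Type) (s : seq I) (P : pred I) (f : I -> L) :
  (forall i, P i -> zspan (f i)) -> zspan (\sum_(i <- s | P i) f i).
Proof.
move=> fi; elim/big_rec: _ => [|i x Pi ix]; first exact: (zspan_int 0).
by apply: zspanD; first exact: fi.
Qed.

Lemma zspan_integral y : zspan y -> integral y.
Proof.
case=> g ->; rewrite horner_coef; apply: integral_sum => i _.
apply: integral_mul; first by rewrite coef_map; apply: integral_id.
by rewrite -zroot_nat; apply: integral_zroot.
Qed.

Lemma zspan_coeffs y :
  zspan y -> exists c : 'Z_q -> int, y = \sum_a (c a)%:~R * zroot a.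
Proof.
case=> g ->; rewrite horner_coef.
elim/big_rec: _ => [|i x _ [c ->]].
  by exists (fun=> 0); rewrite big1 // => a _; rewrite mul0r.
exists (fun a => c a + g`_i *+ (a == i%:R)).
rewrite coef_map /= -zroot_nat [RHS](eq_bigr (fun a =>
  (c a)%:~R * zroot a + (g`_i *+ (a == (i : nat)%:R))%:~R * zroot a)); last first.
  by move=> a _; rewrite intrD mulrDl.
rewrite big_split /= addrC; congr (_ + _).
rewrite (bigD1 (i : nat)%:R) //= eqxx big1 ?addr0 // => a /negPf->.
by rewrite mulr0n mul0r.
Qed.

Local Notation pi := (1 - z).

Lemma pi_neq0 : pi != 0.
Proof.
rewrite subr_eq0 eq_sym -[z]expr1 -zroot_nat zroot_eq1.
exact: oner_neq0.
Qed.

Lemma prod_XsubC_zroot (P : pred 'Z_q) n : (0 < n)%N -> #|P| = n ->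
  (forall u, P u -> zroot u ^+ n = 1) ->
  \prod_(u | P u) ('X - (zroot u)%:P) = 'X^n - 1.
Proof.
move=> n_gt0 cP rP; pose rs := [seq zroot u | u <- enum P].
have srs : size rs = n by rewrite size_map -cardE.
have := @all_roots_prod_XsubC L ('X^n - 1) rs.
rewrite size_XnsubC // srs (monicP _) ?monicXnsubC // scale1r => -> //.
- by rewrite big_map big_enum.
- apply/allP => x /mapP[u]; rewrite mem_enum => Pu ->.
  by rewrite /root !hornerE rP ?subrr.
- by rewrite uniq_rootsE map_inj_uniq ?enum_uniq //; apply: zroot_inj.
Qed.

(** Value at 1 of [('X^q - 1) / ('X^m - 1)], namely [q / m]. *)
Lemma prod_1B_zroot_unit :
  \prod_(u : 'Z_q | u \is a GRing.unit) (1 - zroot u) = p%:R.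
Proof.
pose F : {poly L} := \prod_(u : 'Z_q | u \is a GRing.unit) ('X - (zroot u)%:P).
have Eq : \prod_(u : 'Z_q) ('X - (zroot u)%:P) = 'X^q - 1.
  apply: prod_XsubC_zroot; first by rewrite expn_gt0 prime_gt0.
    by apply: etrans card_Zq; apply: eq_card.
  by move=> u _; rewrite /zroot exprAC (prim_expr_order pz) expr1n.
have Em : \prod_(u : 'Z_q | u \isn't a GRing.unit) ('X - (zroot u)%:P) = 'X^m - 1.
  apply: prod_XsubC_zroot; first exact: ppow_pred_gt0.
    exact: card_nonunit.
  move=> u; rewrite unit_ppowE negbK => /dvdnP[k uk].
  rewrite /zroot uk -exprM -mulnA -ppowE mulnC exprM (prim_expr_order pz).
  by rewrite expr1n.
have : F * ('X^m - 1) = 'X^q - 1.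
  by rewrite -Em -Eq [in RHS](bigID (fun u : 'Z_q => u \is a GRing.unit)).
have X1 : 'X - 1 != 0 :> {poly L} by rewrite polyXsubC_eq0.
rewrite !subrX1 mulrCA => /(mulfI X1).
move/(congr1 (fun f : {poly L} => f.[1])); rewrite hornerM !horner_sum.
have sX k : \sum_(i < k) 'X^i.[1] = k%:R :> L.
  rewrite (eq_bigr (fun=> 1)) => [|i _]; last by rewrite hornerXn expr1n.
  by rewrite sumr_const card_ord.
have m0 : m%:R != 0 :> L by rewrite natr_numfield_eq0 -lt0n ppow_pred_gt0.
rewrite !sX [X in _ = X%:R]ppowE natrM => /(mulIf m0) <-.
by rewrite /F horner_prod; apply: eq_bigr => u _; rewrite hornerXsubC.
Qed.

(** Associates in [Z[z]] of powers of [1 - z]; the unit [w] is carried together with its inverse. *)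
Definition pi_assoc (y : L) :=
  exists N w w', [/\ zspan w, zspan w', w * w' = 1 & y = pi ^+ N * w].

(** Geometric sums show that [1 - z] and [1 - zroot u] divide each other, since [z] is in turn a
    power of [zroot u]. *)
Lemma pi_assoc_1B_zroot u : u \is a GRing.unit -> pi_assoc (1 - zroot u).
Proof.
move=> Uu; pose w := \sum_(i < u) z ^+ i.
pose w' := \sum_(i < (u^-1 : 'Z_q)) zroot u ^+ i.
have E1 : 1 - zroot u = pi * w.
  by rewrite -opprB subrX1 -mulNr opprB.
have E2 : pi = (1 - zroot u) * w'.
  by rewrite -[1 - zroot u]opprB mulNr -subrX1 opprB -zrootM mulrV // zroot1.
exists 1%N, w, w'; split.
- by apply: zspan_sum => i _; apply/zspanX/zspan_gen.
- by apply: zspan_sum => i _; apply/zspanX/zspan_zroot.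
- by apply: (mulfI pi_neq0); rewrite mulrA -E1 -E2 mulr1.
- by rewrite expr1.
Qed.

Lemma prime_pi_assoc : pi_assoc p%:R.
Proof.
rewrite -prod_1B_zroot_unit; elim/big_ind: _ => [||u Uu].
- by exists 0%N, 1, 1; split; rewrite ?mulr1 ?expr0 //; apply: zspan1.
- move=> _ _ [N1 [w1 [w1' [s1 s1' e1 ->]]]] [N2 [w2 [w2' [s2 s2' e2 ->]]]].
  exists (N1 + N2)%N, (w1 * w2), (w1' * w2'); split.
  + exact: zspanM.
  + exact: zspanM.
  + by rewrite mulrACA e1 e2 mulr1.
  + by rewrite exprD mulrACA.
- exact: pi_assoc_1B_zroot.
Qed.

Lemma prime_inv_not_integral : ~ integral p%:R^-1.
Proof.
have -> : p%:R^-1 = (p%:R^-1 : rat)%:A :> L.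
  by rewrite -in_algE fmorphV rmorph_nat.
case/integral_rat_int => k.
have p0 : p%:R != 0 :> rat by rewrite pnatr_eq0 -lt0n prime_gt0.
move/(congr1 (fun x => x * p%:R)); rewrite mulVf // => /eqP.
rewrite -[p%:R]/(p%:Z%:~R) -intrM -[1]/(1%:~R) eqr_int => /eqP kp.
have := prime_gt1 p_pr; have := congr1 absz kp; rewrite abszM /= => /esym/eqP.
by rewrite muln_eq1 => /andP[_ /eqP->].
Qed.

Lemma pi_divides_prime :
  exists N w w', [/\ zspan w, zspan w', w * w' = 1 & p%:R = pi ^+ N.+1 * w].
Proof.
have [[|N] [w [w' [sw sw' ww' E]]]] := prime_pi_assoc; last by exists N, w, w'.
case: prime_inv_not_integral; rewrite E expr0 mul1r.
rewrite (mulr1_eq ww').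
exact: zspan_integral.
Qed.

Lemma pi_inv_not_integral : ~ integral pi^-1.
Proof.
move=> ii; have [N [w [w' [sw sw' ww' E]]]] := pi_divides_prime.
apply: prime_inv_not_integral; rewrite E invfM -exprVn.
rewrite (mulr1_eq ww').
by apply: integral_mul; [apply: integral_exp | apply: zspan_integral].
Qed.

(** If [b] were prime to [p], a Bezout relation divided by [1 - z] would make the inverse of [1 - z]
    integral, because [1 - z] divides [p]. *)
Lemma int_div_pi_integral (b : int) :
  integral (b%:~R / pi) -> exists b' : int, b = b' * p%:Z.
Proof.
move=> ib; apply/dvdzP; apply/negPn/negP => npb.
have cop : coprimez b p%:Z.
  by rewrite coprimez_sym coprimezE prime_coprime // -dvdzE.
have [u [v uv]] := Bezoutz b p%:Z.
apply: pi_inv_not_integral.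
have [N [w [w' [sw sw' ww' E]]]] := pi_divides_prime.
have -> : pi^-1 = u%:~R * (b%:~R / pi) + v%:~R * (pi ^+ N * w).
  have /(congr1 (fun k : int => k%:~R : L)) : u * b + v * p%:Z = 1.
    by rewrite uv (eqP cop).
  rewrite intrD !intrM -[p%:Z%:~R]/(p%:R) E exprS => /(congr1 (fun x => x / pi)).
  rewrite mul1r => Epi; rewrite -{1}Epi mulrDl mulrA; congr (_ + _).
  rewrite -!mulrA; congr (_ * _); rewrite mulrC -!mulrA.
  by rewrite mulVf ?mulr1 ?pi_neq0.
apply: integral_add; apply: integral_mul => //; try exact: integral_id.
apply/zspan_integral/zspanM => //; apply: zspanX.
by apply: zspanD; [exact: zspan1|rewrite -mulN1r; apply: zspanM zspan_gen; exact: (zspan_int (-1))].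
Qed.

(** Reduction mod [1 - z] is evaluation at 1 of a polynomial representing [y], so every residue is
    that of an integer. *)
Lemma zspan_mod_pi y : zspan y ->
  exists (b : int) y', zspan y' /\ y = b%:~R + pi * y'.
Proof.
case=> g ->; have : root (g - g.[1]%:P) 1 by rewrite /root !hornerE subrr.
case/factor_theorem => h Dh; exists g.[1], (- (map_poly intr h).[z]); split.
  by rewrite -mulN1r; apply: zspanM; [exact: (zspan_int (-1))| exists h].
have -> : g = g.[1]%:P + h * ('X - 1%:P) by rewrite -Dh addrC subrK.
rewrite rmorphD rmorphM rmorphB /= map_polyX !map_polyC /= !hornerE.
by rewrite mulrN -mulNr opprB mulrC.
Qed.

(** One factor at a time: the integer residue [b] of [y] has [b / (1 - z)] integral, so [p] divides
    it, and hence [1 - z] divides it inside [Z[z]]. *)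
Lemma zspan_pi_dvd k y : zspan y -> integral (y / pi ^+ k) ->
  exists2 y', zspan y' & y = pi ^+ k * y'.
Proof.
have spi : zspan pi.
  by apply: zspanD; [exact: zspan1|rewrite -mulN1r; apply: zspanM zspan_gen; exact: (zspan_int (-1))].
elim: k y => [|k IH] y sy iy; first by exists y; rewrite ?expr0 ?mul1r.
have [b [y1 [sy1 Ey]]] := zspan_mod_pi sy.
have pi0 := pi_neq0; have pik0 n : pi ^+ n != 0 by rewrite expf_neq0.
have ib : integral (b%:~R / pi).
  have -> : b%:~R / pi = y / pi ^+ k.+1 * pi ^+ k - y1.
    by rewrite exprS invfM mulrA divfK // Ey mulrDl (mulrC pi) mulfK // addrK.
  apply: integral_sub; last exact: zspan_integral.
  by apply: integral_mul => //; apply/zspan_integral/zspanX.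
have [b' Eb] := int_div_pi_integral ib.
have [N [w [w' [sw sw' ww' E]]]] := pi_divides_prime.
pose y2 := b'%:~R * (pi ^+ N * w) + y1.
have Ey2 : y = pi * y2.
  rewrite Ey Eb intrM -[p%:Z%:~R]/(p%:R) E exprS /y2; ring.
have sy2 : zspan y2.
  apply: zspanD => //; apply: zspanM; first exact: zspan_int.
  by apply: zspanM => //; apply: zspanX.
have [|y3 sy3 Ey3] := IH y2 sy2.
  have -> : y2 / pi ^+ k = y / pi ^+ k.+1; last by [].
  by rewrite Ey2 exprS invfM mulrACA divff // mul1r.
by exists y3; rewrite // Ey2 Ey3 exprS mulrA.
Qed.

(** Inversion puts [q * y] in [Z[z]], and total ramification makes [q] a power of [1 - z] times a
    unit of [Z[z]]; the power can then be divided out. *)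
Theorem integral_zspan y : integral y -> zspan y.
Proof.
move=> iy; have [N [w [w' [sw sw' ww' E]]]] := pi_divides_prime.
have sqy : zspan (q%:R * y).
  rewrite -trace_inversion; apply: zspan_sum => a _; apply: zspanM (zspan_zroot a).
  have [|k ->] := @trace_int (y * zroot (- a)); last exact: zspan_int.
  by apply: integral_mul => //; apply: integral_zroot.
have Eq : q%:R = pi ^+ (N.+1 * r) * w ^+ r by rewrite natrX E exprMn exprM.
have pi0 n : pi ^+ n != 0 by rewrite expf_neq0 ?pi_neq0.
have [|y' sy' Ey'] := @zspan_pi_dvd (N.+1 * r)%N _ sqy.
  rewrite Eq -!mulrA mulrC -!mulrA mulVf // mulr1.
  apply: integral_mul => //; apply/zspan_integral/zspanX; exact: sw.
have -> : y = y' * w' ^+ r.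
  move: Ey'; rewrite Eq -mulrA => /(mulfI (pi0 _)) <-.
  by rewrite mulrAC -exprMn ww' expr1n mul1r.
by apply: zspanM => //; apply: zspanX.
Qed.

(** * Complex conjugation and a complex embedding *)

Lemma gal_full_comm (s t : gal_of {:L}) y : s (t y) = t (s y).
Proof.
have E : (t * s)%g = (s * t)%g.
  by apply: cycl_char_inj; rewrite !cycl_charM mulrC.
by rewrite -!galM ?memvf // E.
Qed.

Lemma gal_full_abelian : abelian G.
Proof.
apply/centsP => s _ t _; apply: cycl_char_inj.
by rewrite !cycl_charM mulrC.
Qed.

Lemma conj_zroot_ex : exists c : gal_of {:L}, chi c = -1.
Proof. by apply: cycl_char_surj; rewrite unitrN unitr1. Qed.

Lemma rat_poly_gen_ex (y : L) : exists g : {poly rat}, y == (map_poly (in_alg L) g).[z].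
Proof.
have : y \in <<1; z>>%VS by rewrite gz memvf.
by case/Fadjoin1_polyP => g ->; exists g.
Qed.

(** Write [y] as a rational polynomial in [z] and evaluate it at a complex primitive root [w]. Two
    choices differ by a multiple of the cyclotomic polynomial, which vanishes at [w]. *)
Lemma cyclotomic_iota : inhabited {rmorphism L -> algC}.
Proof.
have [w pw] := C_prim_root_exists (prim_order_gt0 pz).
pose ev (g : {poly rat}) : algC := (map_poly ratr g).[w].
pose gp y := xchoose (rat_poly_gen_ex y).
have gpE y : (map_poly (in_alg L) (gp y)).[z] = y.
  exact/esym/eqP/(xchooseP (rat_poly_gen_ex y)).
have evE (g : {poly rat}) y : (map_poly (in_alg L) g).[z] = y -> ev (gp y) = ev g.
  move=> gy; have : root (map_poly (in_alg L) (gp y - g)) z.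
    by rewrite rmorphB /root !hornerE gpE gy subrr.
  move/(Cyclotomic_dvd_rat pz) => /dvdpP[h Dh].
  apply/eqP; rewrite -subr_eq0 -hornerN -hornerD -rmorphB /= Dh rmorphM hornerM.
  rewrite /= -map_poly_comp (eq_map_poly (g := intr)); last first.
    by move=> k /=; rewrite ratr_int.
  by rewrite (rootP (root_Cyclotomic_prim pw)) mulr0.
have fB : zmod_morphism (fun y => ev (gp y)).
  move=> x y; rewrite (evE (gp x - gp y)); first by rewrite /ev rmorphB !hornerE.
  by rewrite rmorphB !hornerE !gpE.
have fM : monoid_morphism (fun y => ev (gp y)).
  split=> [|x y].
    by rewrite (evE 1) /ev rmorph1 hornerC.
  rewrite (evE (gp x * gp y)); first by rewrite /ev rmorphM !hornerE.
  by rewrite rmorphM !hornerE !gpE.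
pose fBm := GRing.isZmodMorphism.Build _ _ _ fB.
pose fMm := GRing.isMonoidMorphism.Build _ _ _ fM.
pose f : {rmorphism L -> algC} := HB.pack (fun y => ev (gp y)) fBm fMm.
by constructor.
Qed.

Lemma iota_conj (iota : {rmorphism L -> algC}) (c : gal_of {:L}) :
  chi c = -1 -> forall y, iota (c y) = (iota y)^*.
Proof.
move=> cE y; have [g /eqP ->] := rat_poly_gen_ex y.
have cz : iota (c z) = (iota z)^*.
  rewrite -zroot1 gal_zroot cE mulr1 zrootN zroot1 fmorphV.
  have n1 : `|iota z| = 1.
    apply/eqP; rewrite -(@pexpr_eq1 _ _ q) ?normr_ge0 ?expn_gt0 ?prime_gt0 //.
    by rewrite -normrX -rmorphXn (prim_expr_order pz) rmorph1 normr1.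
  by rewrite invC_norm n1 expr1n invr1 mul1r.
have evE (f : {rmorphism L -> algC}) :
    f (map_poly (in_alg L) g).[z] = (map_poly ratr g).[f z].
  rewrite -horner_map -map_poly_comp; congr (_.[_]); apply: eq_map_poly => x /=.
  by rewrite alg_num_field fmorph_rat.
have := evE (iota \o c); rewrite /= => ->; rewrite cz.
by have := evE (Num.conj \o iota).
Qed.

(** * Subfields of the cyclotomic field *)

Section Subfield.

Variables (K : fieldExtType rat) (phi : 'AHom(K, L)).
Local Notation K' := (phi @: {:K})%AS.
Local Notation H := ('Gal({:L} / K'))%g.
Local Notation n := (\dim {:K}).
Local Notation e := #|H|.

Lemma mem_fixed y : reflect (forall h, h \in H -> h y = y) (y \in K').
Proof.
have galH : galois K' {:L}.
  by apply: galoisS (galois_rat_full L); rewrite sub1v subvf.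
apply: (iffP idP) => [Ky h hH|yH]; first exact: fixed_gal (subvf _) hH Ky.
by rewrite -(galois_fixedField galH); apply/fixedFieldP; rewrite ?memvf.
Qed.

Lemma galois_embedded : galois 1 K'.
Proof.
have galH : galois K' {:L}.
  by apply: galoisS (galois_rat_full L); rewrite sub1v subvf.
have nH : normal H G.
  by rewrite -sub_abelian_normal ?gal_full_abelian // galS ?sub1v.
have := normal_fixedField_galois (galois_rat_full L) nH.
by rewrite (galois_fixedField galH).
Qed.

Lemma gal_stable (s : gal_of {:L}) y : y \in K' -> s y \in K'.
Proof.
by move=> /mem_fixed yH; apply/mem_fixed => h hH; rewrite gal_full_comm yH.
Qed.

Lemma card_gal_relative : e = \dim_K' {:L}.
Proof.
have galH : galois K' {:L}.
  by apply: galoisS (galois_rat_full L); rewrite sub1v subvf.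
by rewrite (galois_dim galH).
Qed.

Lemma card_gal_relative_dim : (e * n = totient q)%N.
Proof.
rewrite card_gal_relative -dim_cyclotomic -(dim_embedded phi).
exact/esym/(@dim_sup_field _ _ K' {:L}%AS (subvf _)).
Qed.

Lemma trace_relative w : w \in K' -> Tr w = e%:R * galTrace 1 K' w.
Proof.
by move=> Kw; rewrite (trace_tower galois_embedded Kw) card_gal_relative.
Qed.

(** * Automorphisms congruent to 1 mod p, and descent to a smaller cyclotomic field *)

Lemma nonunitP (a : 'Z_q) : reflect (exists v, a = p%:R * v) (a \isn't a GRing.unit).
Proof.
apply: (iffP idP) => [|[v ->]]; rewrite ?unitrM unit_ppowE ?negbK.
  by case/dvdnP=> k ak; exists k%:R; rewrite -[a]natr_Zp ak natrM mulrC.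
by rewrite negb_and negbK val_Zp_nat ?ppow_gt1 // /dvdn modn_dvdm ?modnn // ppowE dvdn_mulr.
Qed.

Lemma unit_1D_prime (v : 'Z_q) : 1 + p%:R * v \is a GRing.unit.
Proof.
apply/negPn/negP => /nonunitP[w E].
have /nonunitP/negP[] : exists u : 'Z_q, 1 = p%:R * u; last exact: unitr1.
by exists (w - v); rewrite mulrBr -E addrK.
Qed.

Lemma exp1D_third (R : comNzRingType) (x : R) (i : nat) :
  exists w, (1 + x) ^+ i = 1 + i%:R * x + 'C(i, 2)%:R * x ^+ 2 + x ^+ 3 * w.
Proof.
elim: i => [|i [w IH]]; first by exists 0; rewrite expr0 bin_small // mulr0n !mul0r mulr0 !addr0.
exists ('C(i, 2)%:R + w + x * w).
by rewrite exprS IH binS bin1 natrD -[in RHS]addn1 natrD; ring.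
Qed.

Lemma Zq_natr0 : q%:R = 0 :> 'Z_q.
Proof. by rewrite pchar_Zp ?ppow_gt1. Qed.

Lemma cycl_charX s k : chi (s ^+ k)%g = chi s ^+ k.
Proof.
elim: k => [|k IH]; first by rewrite expg0 cycl_char1.
by rewrite expgS cycl_charM IH exprS.
Qed.

(** By induction on [j], the power [chi s ^+ (p ^ j)] is 1 modulo [p ^ j.+1]: the kernel of
    reduction mod [p] is a [p]-group. *)
Lemma cycl_char_ppow_order s : chi s - 1 \isn't a GRing.unit -> (s ^+ q)%g = 1%g.
Proof.
case/nonunitP => v sv; apply: cycl_char_inj; rewrite cycl_char1 cycl_charX.
suff /(_ r)[w ->] : forall j, exists w, chi s ^+ (p ^ j) = 1 + p%:R ^+ j.+1 * w.
  by rewrite exprS -natrX Zq_natr0 mulr0 mul0r addr0.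
elim=> [|j [w IH]].
  by exists v; rewrite expn0 !expr1 -sv addrC subrK.
set x := p%:R ^+ j.+1 * w in IH.
rewrite expnSr exprM IH; have [u ->] := exp1D_third x p.
exists (w + p%:R ^+ j * w ^+ 2 * 'C(p, 2)%:R + p%:R ^+ j * w ^+ 2 * x * u).
by rewrite /x !exprS; ring.
Qed.

Lemma relative_free h : ~~ (p %| e)%N -> h \in H -> h != 1%g ->
  chi h - 1 \is a GRing.unit.
Proof.
move=> npe hH; apply: contraR => /cycl_char_ppow_order/eqP.
rewrite -order_dvdn -order_eq1 => hq; rewrite -dvdn1.
have cop : coprime q e by rewrite coprime_pexpl // prime_coprime.
by rewrite -(eqP cop) dvdn_gcd hq order_dvdG.
Qed.

Lemma rat_coeffs (y : L) : exists c : 'Z_q -> rat, y = \sum_a c a *: zroot a.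
Proof.
have /fin_all_exists[t tE] : forall a, exists c : rat, Tr (y * zroot (- a)) = c%:A.
  move=> a; exact/vlineP/(mem_galTrace (galois_rat_full L) (memvf _)).
exists (fun a => t a / q%:R).
have q0 : q%:R != 0 :> L.
  by rewrite natr_numfield_eq0 -lt0n expn_gt0 prime_gt0.
apply: (mulfI q0); rewrite -trace_inversion mulr_sumr; apply: eq_bigr => a _.
rewrite tE mulr_algl -scalerAr.
have -> : q%:R = q%:R *: 1 :> L by rewrite scaler_nat.
rewrite mulr_algl scalerA divfK //.
by rewrite pnatr_eq0 -lt0n expn_gt0 prime_gt0.
Qed.

(** Take [h] of order [p]; Fermat gives [u = 1 + x] with [p] dividing [x]. As [p] is odd it divides
    ['C(p, 2)], so the expansion of [u ^+ p = 1] reads [p x] times a unit congruent to 1 mod [p]. *)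
Lemma relative_order_p : odd p -> (p %| e)%N ->
  exists2 h, h \in H & [/\ chi h != 1, chi h - 1 \isn't a GRing.unit
                         & p%:R * (chi h - 1) = 0].
Proof.
move=> p_odd /(Cauchy p_pr)[h hH oh]; exists h => //.
have h1 : chi h != 1.
  rewrite -cycl_char1 (inj_eq cycl_char_inj) -order_eq1 oh.
  by case: (p) p_pr => [|[|k]].
set u := chi h.
have up : u ^+ p = 1.
  by have := expg_order h; rewrite oh => /(congr1 chi); rewrite cycl_charX cycl_char1.
have nu1 : u - 1 \isn't a GRing.unit.
  have : (u : nat) ^ p = 1 %[mod p].
    have := congr1 (fun a : 'Z_q => (a : nat) %% p)%N up.
    rewrite -{1}[u]natr_Zp -natrX -[1 in RHS]/(1%:R) !val_Zp_nat ?ppow_gt1 //.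
    by rewrite !modn_dvdm ?ppowE ?dvdn_mulr.
  rewrite fermat_little // (modn_small (prime_gt1 p_pr)) => u1.
  apply/nonunitP; exists (u %/ p)%:R.
  have uE : (u : nat) = (u %/ p * p + 1)%N by rewrite {1}(divn_eq u p) u1.
  by rewrite -{1}[u]natr_Zp {1}uE natrD addrK natrM mulrC.
split=> //; have [x' ux'] := nonunitP _ nu1; set x := u - 1.
have [w] := exp1D_third x p; rewrite /x addrC subrK up bin2odd // => E.
rewrite -/x in E ux'.
have E0 : p%:R * x + (p * p.-1./2)%:R * x ^+ 2 + x ^+ 3 * w = 0.
  by apply: (addrI 1); rewrite addr0 !addrA -E.
have {}E : p%:R * x * (1 + p%:R * ((p.-1./2)%:R * x' + x' ^+ 2 * w)) = 0.
  by rewrite -[RHS]E0 natrM ux'; ring.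
by move/eqP: E; rewrite mulIr_eq0; [move/eqP | apply/mulIr/unit_1D_prime].
Qed.

(** Average over the powers [1 + i x] of [chi h], where [p x = 0]. A term [zroot a] is multiplied by
    the sum of the powers of the [p]-th root of unity [zroot (x * a)], so it survives only if
    [x a = 0]; such an [a] is a multiple of [p]. *)
Lemma relative_descent : odd p -> (p %| e)%N -> (K' <= <<1; z ^+ p>>)%VS.
Proof.
move=> p_odd pe; have [h hH [h1 hn hp]] := relative_order_p p_odd pe.
set x := chi h - 1 in hp; have x0 : x != 0 by rewrite subr_eq0.
apply/subvP => y Ky; have [c yE] := rat_coeffs y.
have chiX i : chi (h ^+ i)%g = 1 + i%:R * x.
  have [x' xE] := nonunitP _ hn; rewrite -/x in xE.
  have xx : x ^+ 2 = 0 by rewrite expr2 {2}xE mulrA (mulrC x) hp mul0r.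
  elim: i => [|i IH]; first by rewrite expg0 cycl_char1 mul0r addr0.
  rewrite expgS cycl_charM IH -[chi h](subrK 1) -/x -[i.+1]addn1 natrD.
  by rewrite mulrDl mulrDr mulrCA -expr2 xx; ring.
have p0 : p%:R != 0 :> rat by rewrite pnatr_eq0 -lt0n prime_gt0.
have py : p%:R *: y = \sum_(i < p) (h ^+ i)%g y.
  rewrite (eq_bigr (fun=> y)) ?sumr_const ?card_ord ?scaler_nat // => i _.
  by move/mem_fixed: Ky => -> //; rewrite groupX.
suff : p%:R *: y \in <<1; z ^+ p>>%VS.
  by move/(memvZ p%:R^-1); rewrite scalerA mulVf // scale1r.
rewrite py yE (eq_bigr (fun i : 'I_p => \sum_a c a *: (zroot a * zroot (x * a) ^+ i))); last first.
  move=> i _; rewrite linear_sum; apply: eq_bigr => a _.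
  rewrite linearZ /= gal_zroot chiX mulrDl mul1r zrootD -mulrA.
  by rewrite zroot_natM.
rewrite exchange_big /=; apply: rpred_sum => a _.
rewrite -scaler_sumr -mulr_sumr; apply: rpredZ.
have [xa|xa] := eqVneq (x * a) 0.
  rewrite (eq_bigr (fun=> 1)) => [|i _]; last by rewrite xa zroot0 expr1n.
  rewrite sumr_const mulrnAr mulr1; apply: rpredMn.
  have /nonunitP[v ->] : a \isn't a GRing.unit.
    by apply: contraNN x0 => Ua; rewrite -(mulrK Ua x) xa mul0r.
  by rewrite zrootM zroot_nat rpredX // memv_adjoin.
have xa1 : zroot (x * a) - 1 != 0 by rewrite subr_eq0 zroot_eq1.
suff -> : \sum_(i < p) zroot (x * a) ^+ i = 0 by rewrite mulr0 rpred0.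
apply: (mulfI xa1); rewrite -subrX1 mulr0 -zroot_natM mulrA hp mul0r zroot0.
by rewrite subrr.
Qed.

Lemma descent_embeds : (1 < r)%N -> (K' <= <<1; z ^+ p>>)%VS -> embeds_in_cyclotomic K m.
Proof.
move=> r_gt1 sKE; pose E := <<1; z ^+ p>>%AS.
pose L1 : fieldExtType rat := subvs_of E.
have zE : z ^+ p \in E by rewrite memv_adjoin.
exists L1.
  exists (vsproj E (z ^+ p)).
    have dv : (m %| q)%N by rewrite [X in (_ %| X)%N]ppowE dvdn_mull.
    have := dvdn_prim_root pz dv.
    have -> : (q %/ m = p)%N by rewrite [X in (X %/ _)%N]ppowE mulnK ?ppow_pred_gt0.
    by rewrite -{1}(vsprojK zE) (fmorph_primitive_root (vsval : {rmorphism L1 -> L})).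
  apply/eqP; rewrite eqEsubv subvf /=; apply/subvP => y _.
  have /Fadjoin1_polyP[g yg] : vsval y \in <<1; z ^+ p>>%VS by apply: subvsP.
  apply/Fadjoin1_polyP; exists g; apply: val_inj.
  rewrite /= yg -{1}(vsprojK zE) -(horner_map (vsval : {rmorphism L1 -> L})) /=.
  rewrite -map_poly_comp; congr (_.[_]); apply: eq_map_poly => x /=.
  by rewrite algid1.
pose f : 'Hom(K, L1) := (linfun (vsproj E) \o phi)%VF.
have fE x : vsval (f x) = phi x.
  by rewrite /f lfunE /= lfunE /= vsprojK // (subvP sKE) // memv_img ?memvf.
have fA : ahom_in {:K} f.
  apply/ahom_inP; split=> [x y _ _|]; apply: val_inj; rewrite /= !fE ?rmorphM //.
  by rewrite rmorph1 algid1.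
by constructor; exact: (AHom fA).
Qed.

(** * Orbits on residues and an equivariant section *)

Hypothesis npe : ~~ (p %| e)%N.

Definition rel_orbit (a : 'Z_q) : {set 'Z_q} := [set chi h * a | h in H].
(** The choice is made from the orbit as a set, hence is constant on it; the default is never
    reached, since the orbit contains [a]. *)
Definition orep (a : 'Z_q) := odflt a [pick b in rel_orbit a].

Lemma rel_orbit_refl a : a \in rel_orbit a.
Proof. by apply/imsetP; exists 1%g; rewrite ?group1 ?cycl_char1 ?mul1r. Qed.

Lemma rel_orbit_act h a : h \in H -> rel_orbit (chi h * a) = rel_orbit a.
Proof.
move=> hH; apply/setP => b; apply/imsetP/imsetP => -[g gH ->].
  by exists (g * h)%g; rewrite ?groupM // cycl_charM mulrA.
exists (g * h^-1)%g; rewrite ?groupM ?groupV // mulrA -cycl_charM.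
by rewrite -mulgA mulVg mulg1.
Qed.

Lemma orep_mem a : orep a \in rel_orbit a.
Proof.
rewrite /orep; case: pickP => [b //|/(_ a)].
by rewrite rel_orbit_refl.
Qed.

Lemma orep_act h a : h \in H -> orep (chi h * a) = orep a.
Proof.
move=> hH; rewrite /orep rel_orbit_act //; case: pickP => [b //|/(_ a)].
by rewrite rel_orbit_refl.
Qed.

Lemma orepE a : exists2 h, h \in H & orep a = chi h * a.
Proof. by have /imsetP := orep_mem a. Qed.

Lemma orepK a : exists2 h, h \in H & a = chi h * orep a.
Proof.
have [h hH ->] := orepE a; exists h^-1%g; rewrite ?groupV //.
by rewrite mulrA -cycl_charM mulVg cycl_char1 mul1r.
Qed.

Lemma orep_id a : orep (orep a) = orep a.
Proof. by have [h hH {1}->] := orepE a; apply: orep_act. Qed.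

Lemma orep0 : orep 0 = 0.
Proof. by have [h _ ->] := orepE 0; rewrite mulr0. Qed.

Lemma rel_orbit_inj a : a != 0 -> {in H &, injective (fun h => chi h * a)}.
Proof.
move=> a0 g h gH hH E; apply/eqP; rewrite -[_ == _]negbK; apply: contraNN a0 => gh.
have U : chi (h^-1 * g)%g - 1 \is a GRing.unit.
  apply: relative_free; rewrite ?groupM ?groupV //.
  by apply: contraNN gh => /eqP/(congr1 (mulg h)); rewrite mulKVg mulg1 => ->.
apply/eqP/(mulrI U)/(mulrI (cycl_char_unit h)).
by rewrite !mulr0 mulrBl mul1r mulrBr mulrA -cycl_charM mulKVg E subrr.
Qed.

(** Every nonzero residue has a free orbit, parametrised once by [H]. The orbit of 0 is a single
    point, so [P] must exclude it. *)
Lemma big_rel_orbit (V : Type) (idx : V) (op : Monoid.com_law idx) (F : 'Z_q -> V)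
    (P : pred 'Z_q) :
  (forall h a, h \in H -> P (chi h * a) = P a) -> ~~ P 0 ->
  \big[op/idx]_(b | P b) F b =
  \big[op/idx]_(a | P a && (orep a == a)) \big[op/idx]_(h in H) F (chi h * a).
Proof.
move=> PH P0.
rewrite (partition_big orep (fun a => P a && (orep a == a))) => [|b Pb]; last first.
  by have [h hH {1}->] := orepE b; rewrite PH // Pb orep_id eqxx.
apply: eq_bigr => a /andP[Pa /eqP oa].
have a0 : a != 0 by apply: contraNneq P0 => <-.
rewrite -(big_imset _ (rel_orbit_inj a0)) /=; apply: eq_bigl => b.
apply/andP/imsetP => [[Pb /eqP <-]|[h hH ->]]; first exact: orepK.
by rewrite PH // orep_act // oa.
Qed.

(** Lifts a class given by its multiple [x] under [p]. The class fixed by all of [H] is lifted to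
    the fixed residue 0, as equivariance demands. *)
Definition class_lift (x : 'Z_q) : 'Z_q :=
  if x == 0 then 0 else odflt 0 [pick v | p%:R * v == x].

Lemma class_liftK v : p%:R * class_lift (p%:R * v) = p%:R * v.
Proof.
rewrite /class_lift; case: eqP => [->|_]; first by rewrite mulr0.
by case: pickP => [w /eqP //|/(_ v)]; rewrite eqxx.
Qed.

Definition class_twist (x : 'Z_q) : gal_of {:L} :=
  odflt 1%g [pick h | (h \in H) && (x == chi h * orep x)].

Lemma class_twistP x : class_twist x \in H /\ x = chi (class_twist x) * orep x.
Proof.
rewrite /class_twist; case: pickP => [h /andP[hH /eqP //]|].
by have [h hH xE] := orepK x; move/(_ h); rewrite hH -xE eqxx.
Qed.

(* An H-equivariant section of the reduction of residues mod [p ^ r] to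
   residues mod [p ^ r.-1]; the class of [a] is encoded by [p * a]. *)
Definition csec (a : 'Z_q) : 'Z_q :=
  chi (class_twist (p%:R * a)) * class_lift (orep (p%:R * a)).

Lemma csecK a : p%:R * csec a = p%:R * a.
Proof.
have [_ E] := class_twistP (p%:R * a).
rewrite [RHS]E /csec mulrCA; congr (_ * _); have [h _ ->] := orepE (p%:R * a).
by rewrite mulrCA class_liftK.
Qed.

Lemma csec_class a b : p%:R * a = p%:R * b -> csec a = csec b.
Proof. by rewrite /csec => ->. Qed.

Lemma csec_id a : csec (csec a) = csec a.
Proof. by apply: csec_class; rewrite csecK. Qed.

Lemma csec_prime0 a : p%:R * a = 0 -> csec a = 0.
Proof. by move=> pa; rewrite /csec pa orep0 /class_lift eqxx mulr0. Qed.

Lemma csec0 : csec 0 = 0.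
Proof. by rewrite csec_prime0 ?mulr0. Qed.

(** For nonzero [p%:R * a] the representative of its orbit is moved freely, so the twist of
    [chi h * (p%:R * a)] can only be [h] times that of [p%:R * a]. The remaining class is sent to
    0. *)
Lemma csec_act h a : h \in H -> csec (chi h * a) = chi h * csec a.
Proof.
move=> hH; have [pa|pa] := eqVneq (p%:R * a) 0.
  by rewrite !csec_prime0 ?mulr0 // mulrCA pa mulr0.
have E : p%:R * (chi h * a) = chi h * (p%:R * a) by rewrite mulrCA.
rewrite /csec E orep_act // [RHS]mulrA -cycl_charM; congr (chi _ * _).
have [gH gE] := class_twistP (p%:R * a).
have [g'H g'E] := class_twistP (chi h * (p%:R * a)).
have o0 : orep (p%:R * a) != 0 by apply: contraNneq pa => o0; rewrite gE o0 mulr0.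
apply: (rel_orbit_inj o0); rewrite ?groupM //=.
by rewrite -(orep_act _ hH) -g'E orep_act // cycl_charM -mulrA -gE.
Qed.

(** One residue per [H]-orbit in each set: off the section for [kept], which indexes the periods of
    the basis, and on it for [blocks], which stands for the orbits of classes mod [p ^ r.-1], that
    of 0 included. *)
Definition kept : {set 'Z_q} := [set a | (csec a != a) && (orep a == a)].
Definition blocks : {set 'Z_q} := [set a | (csec a == a) && (orep a == a)].

Lemma csec_fixed_act h a : h \in H -> (csec (chi h * a) == chi h * a) = (csec a == a).
Proof. by move=> hH; rewrite csec_act // (inj_eq (mulrI (cycl_char_unit h))). Qed.

Lemma card_csec : #|[pred a | csec a == a]| = m.
Proof.
have -> : #|[pred a | csec a == a]| = #|[set a | csec a == a]| by rewrite cardsE.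
rewrite -card_nonunit -(card_in_imset (f := fun a => p%:R * a)
  (D := [set a | csec a == a])); last first.
  by move=> a b; rewrite !inE => /eqP <- /eqP <- E; apply: csec_class; rewrite -csecK E csecK.
rewrite -[RHS]cardsE; apply/esym/eq_card => u; rewrite !inE.
apply/nonunitP/imsetP => [[v ->]|[v _ ->]]; last by exists v.
by exists (csec v); rewrite ?inE ?csec_id ?csecK.
Qed.

Lemma sum_kept (F : 'Z_q -> nat) :
  (\sum_(b | csec b != b) F b = \sum_(a in kept) \sum_(h in H) F (chi h * a)%R)%N.
Proof.
rewrite (@big_rel_orbit _ _ addn F (fun b => csec b != b)); last by rewrite csec0 eqxx.
  by apply: eq_bigl => a; rewrite inE.
by move=> h a hH; rewrite csec_fixed_act.
Qed.

Lemma card_kept : #|kept| = n.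
Proof.
have := sum_kept (fun=> 1%N).
rewrite [X in _ = X](eq_bigr (fun=> e)) => [|a _]; last by rewrite /= sum1_card.
rewrite sum_nat_const => E.
have := etrans (cardC [pred a : 'Z_q | csec a == a]) card_Zq.
rewrite card_csec -[in RHS]totient_ppow addnC => /addIn.
move=> E2.
have e_gt0 : (0 < e)%N by rewrite cardG_gt0.
apply/eqP; rewrite -(eqn_pmul2r e_gt0) -E; apply/eqP.
by rewrite mulnC card_gal_relative_dim -E2 -[RHS]sum1_card; apply: eq_bigl.
Qed.

Lemma mem0_blocks : 0 \in blocks.
Proof. by rewrite inE csec0 orep0 !eqxx. Qed.

(** The block of 0 accounts for one class; the other [m - 1] classes fall into free orbits. *)
Lemma card_blocks : (#|blocks|.-1 * e + 1 = m)%N.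
Proof.
have := @big_rel_orbit _ _ addn (fun=> 1%N) (fun b => (csec b == b) && (b != 0)).
rewrite eqxx andbF => /(_ _ isT) E.
have {}E : #|[pred b | (csec b == b) && (b != 0)]| = (#|blocks|.-1 * e)%N.
  rewrite -[LHS]sum1_card; apply: etrans (E _) _ => [h a hH|].
    rewrite csec_fixed_act // -{1}(mulr0 (chi h)).
    by rewrite (inj_eq (mulrI (cycl_char_unit h))).
  rewrite (eq_bigr (fun=> e)) => [|a _]; last by rewrite /= sum1_card.
  rewrite sum_nat_const; congr (_ * _)%N.
  rewrite (cardsD1 0 blocks) mem0_blocks /=; apply: eq_card => a; rewrite !inE.
  by rewrite unfold_in /=; case: (a == 0); case: (csec a == a).
have := cardD1 0 [pred a | csec a == a]; rewrite card_csec inE csec0 eqxx => ->.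
rewrite -E addn1 add1n; congr _.+1.
by apply: eq_card => a; rewrite !inE andbC.
Qed.

Lemma card_class a : #|[pred b : 'Z_q | p%:R * b == p%:R * a]| = p.
Proof.
pose k := (\sum_(b : 'Z_q | (p%:R * b == 0)%R) 1)%N.
have kE (v : 'Z_q) : (\sum_(b : 'Z_q | (p%:R * b == p%:R * v)%R) 1 = k)%N.
  rewrite (reindex_inj (addrI v)) /=; apply: eq_bigl => b.
  by rewrite mulrDr -subr_eq0 addrAC subrr add0r.
have E : (q = m * k)%N.
  rewrite -[LHS]card_Zq -sum1_card.
  rewrite (partition_big (fun b : 'Z_q => p%:R * b) [pred u | u \isn't a GRing.unit]).
    rewrite (eq_bigr (fun=> k)); first by rewrite sum_nat_const card_nonunit.
    by move=> u /nonunitP[v ->] /=; rewrite kE.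
  by move=> b _; apply/nonunitP; exists b.
have := kE a; rewrite sum1_card => ->.
move: E; rewrite {1}ppowE mulnC => /eqP; rewrite eqn_pmul2l ?ppow_pred_gt0 //.
by move/eqP.
Qed.

Definition class_count (a b : 'Z_q) : nat :=
  (\sum_(h in H) (p%:R * (chi h * a) == p%:R * b)%R)%N.

(** The class of [b] has [p] members, one of them on the section; the orbits of the kept residues
    share the others. *)
Lemma sum_class_count b : (\sum_(a in kept) class_count a b = p.-1)%N.
Proof.
rewrite /class_count -(sum_kept (fun a => p%:R * a == p%:R * b)%R).
have pE : (p.-1 + 1)%N = p by rewrite addn1 prednK ?prime_gt0.
apply: (@addIn 1); apply: etrans (esym pE); apply: etrans (card_class b).
rewrite -[RHS]sum1_card [RHS]big_mkcond /=.
rewrite [RHS](bigID (fun a => csec a != a)) /=; congr (_ + _)%N.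
rewrite (bigD1 (csec b)) /=; last by rewrite csec_id eqxx.
rewrite inE csecK eqxx big1 // => a /andP[]; rewrite negbK => /eqP sa ab.
rewrite inE; case: eqP => // E; case/negP: ab; rewrite -sa.
by apply/eqP/csec_class.
Qed.

Lemma class_count_act a b h : h \in H -> class_count a (chi h * b) = class_count a b.
Proof.
move=> hH; rewrite /class_count (reindex_inj (mulgI h)) /=.
apply: eq_big => [g|g _]; first by rewrite groupMl.
rewrite cycl_charM -mulrA mulrCA [X in _ == X]mulrCA.
by rewrite (inj_eq (mulrI (cycl_char_unit h))).
Qed.

Lemma class_count_block a b : class_count a (orep (csec b)) = class_count a b.
Proof.
have [h hH ->] := orepE (csec b); rewrite class_count_act //.
by rewrite /class_count csecK.
Qed.

Lemma class_count_eq0 a b : b \in blocks -> orep (csec a) != b -> class_count a b = 0%N.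
Proof.
rewrite inE => /andP[/eqP sb /eqP ob] nab; apply: big1 => h hH.
case: eqP => // /csec_class; rewrite csec_act // sb => E.
by case/negP: nab; rewrite -ob -E orep_act.
Qed.

Lemma block_mem a : orep (csec a) \in blocks.
Proof.
rewrite inE orep_id eqxx andbT; have [h hH ->] := orepE (csec a).
by rewrite csec_act // csec_id.
Qed.

(** * Gaussian periods and an integral basis *)

Definition period (a : 'Z_q) : L := \sum_(h in H) zroot (chi h * a).

Lemma period_mem a : period a \in K'.
Proof.
apply/mem_fixed => g gH; rewrite rmorph_sum /= [RHS](reindex_inj (mulgI g)) /=.
apply: eq_big => [h|h _]; first by rewrite groupMl.
by rewrite gal_zroot cycl_charM mulrA.
Qed.

Lemma period_integral a : integral (period a).
Proof. by apply: integral_sum => h _; apply: integral_zroot. Qed.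

Lemma zroot_class_neq1 : zroot m%:R != 1.
Proof.
rewrite zroot_nat -(prim_order_dvd pz); apply/negP => /dvdn_leq.
move/(_ ppow_pred_gt0); rewrite leqNgt {1}ppowE -{1}[m]mul1n.
by rewrite ltn_pmul2r ?ppow_pred_gt0 // prime_gt1.
Qed.

(** Translation by [m] leaves [f] unchanged and multiplies the sum by a nontrivial [p]-th root of
    unity. *)
Lemma sum_class_zroot (f : 'Z_q -> rat) :
  (forall a b, p%:R * a = p%:R * b -> f a = f b) -> \sum_a f a *: zroot a = 0.
Proof.
move=> fc; set S := \sum_a _.
have : S = zroot m%:R * S.
  rewrite {1}/S (reindex_inj (addrI m%:R)) /= mulr_sumr; apply: eq_bigr => a _.
  rewrite zrootD -scalerAr; congr (_ *: _); apply: fc.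
  by rewrite mulrDr -natrM -ppowE Zq_natr0 add0r.
move/eqP; rewrite -subr_eq0 -{1}[S]mul1r -mulrBl mulf_eq0 subr_eq0 eq_sym.
by rewrite (negPf zroot_class_neq1) => /eqP.
Qed.

Lemma traceZ (k : rat) x : Tr (k *: x) = k *: Tr x.
Proof. by rewrite /galTrace scaler_sumr; apply: eq_bigr => s _; rewrite linearZ. Qed.

Lemma trace_zroot_alg a :
  Tr (zroot a) = ((q * (a == 0))%:R - (m * (p%:R * a == 0))%:R : rat)%:A.
Proof. by rewrite trace_zroot scalerBl !scaler_nat. Qed.

(** Subtracting the value on the section normalises the coefficients to vanish there. Invariance
    comes from traces: [t a], the trace of [y * zroot (- a)], is constant on orbits, and
    [q * f a = t a - t (csec a)] because the class sums cancel. *)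
Lemma coeffs_invariant (c : 'Z_q -> rat) y (f := fun a => c a - c (csec a)) :
  y \in K' -> y = \sum_a c a *: zroot a ->
  y = \sum_a f a *: zroot a /\ (forall h a, h \in H -> f (chi h * a) = f a).
Proof.
move=> /mem_fixed yH yE; split.
  rewrite yE [RHS](eq_bigr (fun a => c a *: zroot a - c (csec a) *: zroot a)) => [|a _]; last first.
    by rewrite scalerBl.
  rewrite sumrB [X in _ - X]sum_class_zroot ?subr0 // => a b /csec_class -> //.
pose S (a : 'Z_q) := \sum_(b : 'Z_q | p%:R * b == p%:R * a) c b.
pose t (a : 'Z_q) := q%:R * c a - m%:R * S a.
have tE (a : 'Z_q) : Tr (y * zroot (- a)) = (t a)%:A.
  rewrite yE mulr_suml raddf_sum /=.
  rewrite (eq_bigr (fun b => (c b * ((q * (b - a == 0))%:R -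
      (m * (p%:R * (b - a) == 0))%:R))%:A)) => [|b _]; last first.
    by rewrite -scalerAl -zrootD traceZ trace_zroot_alg scalerA.
  rewrite -scaler_suml; congr (_ *: _); rewrite /t.
  rewrite (eq_bigr (fun b => q%:R * (c b *+ (b == a)) -
      m%:R * (c b *+ (p%:R * b == p%:R * a)))) => [|b _]; last first.
    have -> : (p%:R * (b - a) == 0) = (p%:R * b == p%:R * a) by rewrite mulrBr subr_eq0.
    rewrite subr_eq0 !natrM -[c b *+ (b == a)]mulr_natr.
    by rewrite -[c b *+ (p%:R * b == _)]mulr_natr; ring.
  rewrite sumrB -!mulr_sumr; congr (_ * _ - _ * _).
    by rewrite (bigD1 a) //= eqxx mulr1n big1 ?addr0 // => b /negPf->.
  by rewrite /S [RHS]big_mkcond; apply: eq_bigr => b _; case: (_ == _).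
have tH h a : h \in H -> t (chi h * a) = t a.
  move=> hH; apply: (fmorph_inj (in_alg L)); rewrite /= -!tE.
  rewrite -(galTrace_gal (memvf (y * zroot (- a))) (mem_gal_full h)) rmorphM /=.
  by rewrite gal_zroot yH // mulrN.
have q0 : q%:R != 0 :> rat by rewrite pnatr_eq0 -lt0n expn_gt0 prime_gt0.
have fE a : q%:R * f a = t a - t (csec a).
  have -> : t (csec a) = q%:R * c (csec a) - m%:R * S a.
    by rewrite /t /S csecK.
  by rewrite /f /t; ring.
by move=> h a hH; apply: (mulfI q0); rewrite !fE csec_act // (tH h a hH) (tH h (csec a) hH).
Qed.

Lemma period_expansion (f : 'Z_q -> rat) :
  (forall h a, h \in H -> f (chi h * a) = f a) -> (forall a, csec a = a -> f a = 0) ->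
  \sum_a f a *: zroot a = \sum_(a in kept) f a *: period a.
Proof.
move=> fH f0; rewrite (bigID (fun a => csec a != a)) /= [X in _ + X]big1 ?addr0; last first.
  by move=> a; rewrite negbK => /eqP/f0->; rewrite scale0r.
rewrite (@big_rel_orbit _ _ +%R _ (fun a => csec a != a)); last by rewrite csec0 eqxx.
  apply: eq_big => [a|a _]; first by rewrite inE.
  by rewrite scaler_sumr; apply: eq_bigr => h hH; rewrite fH.
by move=> h a hH; rewrite csec_fixed_act.
Qed.

Definition kept_enum : 'I_n -> 'Z_q := cast_enum card_kept.

Definition period_basis : n.-tuple K :=
  mktuple (fun i => (phi^-1)%VF (period (kept_enum i))).

Lemma phi_period_basis i : phi (tnth period_basis i) = period (kept_enum i).
Proof. by rewrite tnth_mktuple limg_lfunVK // period_mem. Qed.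

(** One expansion serves over the rationals and over the integers: the normalisation
    [c a - c (csec a)] keeps integer coefficients integers. *)
Lemma integral_basis_period : integral_basis period_basis.
Proof.
have phi_inj : injective phi by apply: fmorph_inj.
split.
  rewrite basisEdim size_tuple leqnn andbT; apply/subvP => x _.
  have [c xE] := rat_coeffs (phi x).
  have [xf fH] := coeffs_invariant (mem_embedded phi x) xE.
  rewrite period_expansion // in xf; last by move=> a ->; rewrite subrr.
  have -> : x = \sum_(i < n) (c (kept_enum i) - c (csec (kept_enum i))) *: tnth period_basis i.
    apply: phi_inj; rewrite xf -(big_cast_enum card_kept _ (fun a =>
      (c a - c (csec a)) *: period a)) linear_sum; apply: eq_bigr => i _.
    by rewrite linearZ /= phi_period_basis.
  by apply: rpred_sum => i _; apply/rpredZ/memv_span/mem_tnth.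
move=> x; split=> [ix|[k ->]]; last first.
  apply: integral_sum => i _; rewrite -mulrzr; apply: integral_mul.
    apply: (integral_fmorph phi _).1; rewrite /= phi_period_basis.
    exact: period_integral.
  exact: integral_id.
have /integral_zspan/zspan_coeffs[k xE] : integral (phi x).
  exact: (integral_fmorph phi _).2.
have {}xE : phi x = \sum_a (k a)%:~R *: zroot a.
  rewrite xE; apply: eq_bigr => a _.
  by rewrite -mulr_algl -in_algE rmorph_int.
have [xf fH] := coeffs_invariant (mem_embedded phi x) xE.
rewrite period_expansion // in xf; last by move=> a ->; rewrite subrr.
exists (fun i => k (kept_enum i) - k (csec (kept_enum i))).
apply: phi_inj; rewrite xf -(big_cast_enum card_kept _ (fun a =>
  ((k a)%:~R - (k (csec a))%:~R) *: period a)) rmorph_sum; apply: eq_bigr => i _.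
by rewrite rmorphMz /= phi_period_basis -rmorphB /= -mulr_algl -in_algE rmorph_int mulrzl.
Qed.

(** * Gram matrix and discriminant *)

Variable c : gal_of {:L}.
Hypothesis chic : chi c = -1.

Lemma conj_zroot a : c (zroot a) = zroot (- a).
Proof. by rewrite gal_zroot chic mulN1r. Qed.

Lemma trace_period a b : a \in kept -> b \in kept ->
  galTrace 1 K' (period a * c (period b)) =
  (q%:R * (a == b)%:R - m%:R * (class_count a b)%:R : rat)%:A.
Proof.
rewrite !inE => /andP[sa /eqP oa] /andP[sb /eqP ob].
have a0 : a != 0 by apply: contraNneq sa => ->; rewrite csec0.
have e0 : e%:R != 0 :> L by rewrite natr_numfield_eq0 -lt0n cardG_gt0.
apply: (mulfI e0); rewrite -trace_relative; last first.
  by rewrite rpredM ?gal_stable ?period_mem.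
have -> : period a * c (period b) =
    \sum_(h in H) \sum_(g in H) h (zroot (chi g * a - b)).
  rewrite /period mulrC rmorph_sum mulr_suml; apply: eq_bigr => h hH.
  rewrite mulr_sumr (reindex_inj (mulgI h)) /=; apply: eq_big => [g|g _].
    by rewrite groupMl.
  rewrite conj_zroot -zrootD gal_zroot cycl_charM; congr zroot; ring.
rewrite raddf_sum /= (eq_bigr (fun=> \sum_(g in H) Tr (zroot (chi g * a - b)))) => [|h hH]; last first.
  rewrite raddf_sum; apply: eq_bigr => g _.
  by rewrite /= galTrace_gal ?memvf ?mem_gal_full.
rewrite sumr_const -[LHS]mulr_natl; congr (_ * _).
rewrite (eq_bigr (fun g => (q%:R * (chi g * a == b)%:R -
    m%:R * (p%:R * (chi g * a) == p%:R * b)%:R : rat)%:A)) => [|g _]; last first.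
  by rewrite trace_zroot_alg subr_eq0 mulrBr subr_eq0 !natrM.
rewrite -scaler_suml; congr (_ *: _); rewrite sumrB -!mulr_sumr -!natr_sum.
(* Both residues represent their orbits and [a] is nonzero, so [chi g * a = b] forces [a = b] and
   [g = 1]. *)
congr (_ * _%:R - _); rewrite (bigD1 1%g) ?group1 //= cycl_char1 mul1r.
rewrite big1 ?addn0 // => g /andP[gH g1]; apply/eqP; rewrite eqb0.
apply: contraNN g1 => /eqP gab; apply/eqP.
have ab : a = b by rewrite -oa -ob -gab orep_act.
by apply: (rel_orbit_inj a0); rewrite ?group1 //= gab cycl_char1 mul1r.
Qed.

(** [class_count a b] depends on [b] only through its block and vanishes unless [a] lies over that
    block. Hence the count matrix factors through the blocks as [p * X * Y], and [Y *m X] is the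
    scalar [(p - 1) / p]; each block contributes a factor [1 / p]. *)
Lemma gram_det :
  \det (\matrix_(i, j) galTrace 1 K' (phi (tnth period_basis i) * c (phi (tnth period_basis j)))) =
  (q%:R ^+ n / p%:R ^+ #|blocks|)%:A.
Proof.
pose nb := #|blocks|.
pose bl (j : 'I_nb) : 'Z_q := enum_val j.
have p0 : p%:R != 0 :> rat by rewrite pnatr_eq0 -lt0n prime_gt0.
have m0 : m%:R != 0 :> rat by rewrite pnatr_eq0 -lt0n ppow_pred_gt0.
pose X : 'M[rat]_(n, nb) := \matrix_(i, j) ((class_count (kept_enum i) (bl j))%:R / p%:R).
pose Y : 'M[rat]_(nb, n) := \matrix_(i, j) (orep (csec (kept_enum j)) == bl i)%:R.
have XY i j : (X *m Y) i j = (class_count (kept_enum i) (kept_enum j))%:R / p%:R.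
  have bj := block_mem (kept_enum j).
  rewrite mxE (bigD1 (enum_rank_in bj (orep (csec (kept_enum j))))) //= !mxE.
  rewrite /bl enum_rankK_in // eqxx mulr1 class_count_block big1 ?addr0 // => k kj.
  rewrite !mxE; case: eqP => [E|_]; last by rewrite mulr0.
  by case/eqP: kj; apply: enum_val_inj; rewrite enum_rankK_in // E.
have YX : Y *m X = (p.-1%:R / p%:R)%:M.
  apply/matrixP => i j; rewrite !mxE.
  rewrite (eq_bigr (fun k => (i == j)%:R * ((class_count (kept_enum k) (bl j))%:R / p%:R))); last first.
    move=> k _; rewrite !mxE; have [<-|ij] := eqVneq i j.
      case: eqP => [//|/eqP E]; rewrite class_count_eq0 ?mul0r ?mulr0 //.
      exact: enum_valP.
    rewrite mul0r; case: eqP => [E|_]; last by rewrite mul0r.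
    rewrite mul1r class_count_eq0 ?mul0r ?enum_valP // E.
    by apply: contraNneq ij => /enum_val_inj->.
  rewrite -mulr_sumr -mulr_suml -natr_sum.
  rewrite (big_cast_enum card_kept _ (fun a => class_count a (bl j))) /= sum_class_count.
  by rewrite mulr_natl.
have gramE (Z : 'M[rat]_n) :
    (forall i j, Z i j = (class_count (kept_enum i) (kept_enum j))%:R / p%:R) ->
    \matrix_(i, j) galTrace 1 K' (phi (tnth period_basis i) * c (phi (tnth period_basis j)))
    = map_mx (in_alg L) (q%:R *: (1%:M - Z)).
  move=> ZE; apply/matrixP => i j; rewrite !mxE ZE !phi_period_basis.
  rewrite trace_period ?mem_cast_enum //; congr (_ *: _).
  rewrite (inj_eq (@cast_enum_inj _ _ _ card_kept)) mulrBr; congr (_ - _).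
  by rewrite ppowE natrM; field.
rewrite (gramE _ XY).
rewrite det_map_mx detZ det_1B_mulmxC YX.
have -> : 1%:M - (p.-1%:R / p%:R)%:M = (p%:R^-1)%:M :> 'M[rat]_nb.
  rewrite -raddfB /=; congr (_%:M).
  have pE : p%:R = p.-1%:R + 1 :> rat by rewrite natr1 prednK ?prime_gt0.
  by rewrite -{1}(divff p0) -mulrBl {1}pE addrAC subrr add0r mul1r.
by rewrite det_scalar exprVn.
Qed.

Lemma abs_disc_embedded : abs_disc K = q%:R ^+ n / p%:R ^+ #|blocks|.
Proof.
have d_gt0 : 0 < q%:R ^+ n / p%:R ^+ #|blocks| :> rat.
  by rewrite divr_gt0 ?exprn_gt0 ?ltr0n ?expn_gt0 ?prime_gt0.
have cK y : y \in K' -> c y \in K' by apply: gal_stable.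
have dE := basis_disc_gram galois_embedded (gal_full_comm c) cK gram_det.
rewrite (gtr0_norm d_gt0) in dE.
rewrite /abs_disc; case: xgetP => [D _ [b ib ->]|/(_ `|basis_disc period_basis|)[]].
  rewrite -dE; apply: (basis_disc_unique galois_embedded) => //.
    exact: integral_basis_period.
  by rewrite -normr_gt0 dE.
by exists period_basis => //; apply: integral_basis_period.
Qed.

(** * Covering bounds *)

(** The trace is exactly [q] times the sum of squares minus [m] times the sum of the squares of the
    class sums [S nu]. *)
Lemma trace_form_le (g : 'Z_q -> rat) (u := \sum_a g a *: zroot a) :
  exists2 B : rat, Tr (u * c u) = B%:A & B <= q%:R * \sum_a g a ^+ 2.
Proof.
pose N := \sum_a \sum_b g a * g b * (p%:R * (a - b) == 0)%:R.
exists (q%:R * \sum_a g a ^+ 2 - m%:R * N).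
  have -> : u * c u = \sum_a \sum_b (g a * g b) *: zroot (a - b).
    rewrite /u mulr_suml; apply: eq_bigr => a _; rewrite linear_sum mulr_sumr.
    apply: eq_bigr => b _; rewrite linearZ /= conj_zroot zrootD.
    by rewrite -scalerAl -scalerAr scalerA.
  rewrite raddf_sum (eq_bigr (fun a => \sum_b (g a * g b * ((q * (a - b == 0))%:R -
      (m * (p%:R * (a - b) == 0))%:R))%:A)) => [|a _]; last first.
    rewrite raddf_sum; apply: eq_bigr => b _.
    by rewrite /= traceZ trace_zroot_alg scalerA.
  rewrite (eq_bigr (fun a => (q%:R * g a ^+ 2 -
      m%:R * \sum_b g a * g b * (p%:R * (a - b) == 0)%:R)%:A)) => [|a _]; last first.
    rewrite -scaler_suml; congr (_ *: _).
    rewrite (eq_bigr (fun b => q%:R * (g a * g b * (a - b == 0)%:R) -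
        m%:R * (g a * g b * (p%:R * (a - b) == 0)%:R))) => [|b _]; last first.
      by rewrite !natrM; ring.
    rewrite sumrB -!mulr_sumr; congr (_ * _ - _).
    rewrite (bigD1 a) //= subrr eqxx mulr1 big1 ?addr0 // => b ba.
    by rewrite subr_eq0 eq_sym (negPf ba) mulr0.
  by rewrite -scaler_suml sumrB -!mulr_sumr.
rewrite gerBl mulr_ge0 ?ler0n //.
pose S nu := \sum_(b : 'Z_q | p%:R * b == nu) g b.
have -> : N = \sum_nu S nu ^+ 2.
  rewrite /N (partition_big (fun a : 'Z_q => p%:R * a) predT) //=; apply: eq_bigr => nu _.
  rewrite expr2 {1}/S mulr_suml; apply: eq_bigr => a /eqP pa.
  rewrite /S mulr_sumr [RHS]big_mkcond /=; apply: eq_bigr => b _.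
  rewrite mulrBr subr_eq0 pa eq_sym; case: (_ == _); last by rewrite mulr0.
  by rewrite mulr1.
by rewrite sumr_ge0 // => nu _; rewrite sqr_ge0.
Qed.

Variable iota : {rmorphism L -> algC}.

(** The integers [k a] must be [H]-invariant to give an element of [K]; the shift [s] represents 0
    and only has to be constant on classes. Division by [e] passes from the trace of [L] to that of
    [K]. *)
Lemma covering_bound (x : K) (f : 'Z_q -> rat) (k : 'Z_q -> int) (s : 'Z_q -> rat) :
  phi x = \sum_a f a *: zroot a ->
  (forall h a, h \in H -> k (chi h * a) = k a) ->
  (forall a b, p%:R * a = p%:R * b -> s a = s b) ->
  exists2 y : K, ring_of_integers y &
    abs_norm (x - y) ^+ 2 <=
    (q%:R * (\sum_a (f a - (k a)%:~R - s a) ^+ 2) / e%:R / n%:R) ^+ n.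
Proof.
move=> xE kH sc; pose w := \sum_a (k a)%:~R *: zroot a.
have wK : w \in K'.
  apply/mem_fixed => h hH; rewrite /w linear_sum /= [RHS](reindex_inj (mulrI (cycl_char_unit h))).
  by apply: eq_bigr => a _; rewrite linearZ /= gal_zroot kH.
have [y _ wy] := memv_imgP wK.
have iw : integral w.
  apply: integral_sum => a _; rewrite -mulr_algl -in_algE rmorph_int.
  by apply: integral_mul; [apply: integral_id | apply: integral_zroot].
exists y; first by apply: (integral_fmorph phi _).1; rewrite /= -wy.
have uE : phi (x - y) = \sum_a (f a - (k a)%:~R - s a) *: zroot a.
  rewrite (eq_bigr (fun a => f a *: zroot a - (k a)%:~R *: zroot a - s a *: zroot a)); last first.
    by move=> a _; rewrite !scalerBl.
  by rewrite !sumrB (sum_class_zroot sc) subr0 rmorphB /= xE -wy.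
have [B TB leB] := trace_form_le (fun a => f a - (k a)%:~R - s a).
rewrite -uE in TB.
have cK v : v \in K' -> c v \in K' by apply: gal_stable.
have e0 : e%:R != 0 :> rat by rewrite pnatr_eq0 -lt0n cardG_gt0.
apply: (abs_norm_AGM galois_embedded (gal_full_comm c) cK (iota_conj iota chic)
  (B := B / e%:R)); last by rewrite ler_wpM2r ?invr_ge0 ?ler0n.
have e0L : e%:R != 0 :> L by rewrite natr_numfield_eq0 -lt0n cardG_gt0.
apply: (mulfI e0L); rewrite -trace_relative; last first.
  by rewrite rpredM ?cK ?mem_embedded.
by rewrite TB -scaler_nat mulr_algl scalerA mulrC divfK.
Qed.

Lemma covering_general (x : K) : exists2 y : K, ring_of_integers y &
  abs_norm (x - y) ^+ 2 <= (q%:R ^+ 2 / (12 * e%:R * n%:R)) ^+ n.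
Proof.
have [g xE] := rat_coeffs (phi x).
pose f (a : 'Z_q) := g a - g (csec a).
have [xf fH] := coeffs_invariant (mem_embedded phi x) xE.
have [t [k [kf le]]] := exists_shift_rounding predT f.
have kH (h : gal_of {:L}) (a : 'Z_q) : h \in H -> k (chi h * a) = k a by move=> hH; apply/kf/fH.
have [//|y iy ley] := covering_bound (s := fun=> t) xf kH.
exists y => //; apply: le_trans ley _.
rewrite lerXn2r ?nnegrE ?mulr_ge0 ?invr_ge0 ?ler0n ?sumr_ge0 ?exprn_ge0 ?mulr_ge0 ?ler0n //.
  by move=> a _; rewrite sqr_ge0.
have {}le : \sum_a (f a - (k a)%:~R - t) ^+ 2 <= q%:R / 12.
  by rewrite -[X in X%:R / _]card_Zq.
apply: (@le_trans _ _ (q%:R * (q%:R / 12) / e%:R / n%:R)).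
  by rewrite !ler_wpM2r ?invr_ge0 ?ler0n // ler_wpM2l ?ler0n.
by rewrite expr2 !invfM !mulrA.
Qed.

Lemma card_blocks_rat : #|blocks|%:R = (m%:R - 1) / e%:R + 1 :> rat.
Proof.
have e0 : e%:R != 0 :> rat by rewrite pnatr_eq0 -lt0n cardG_gt0.
have b_gt0 : (0 < #|blocks|)%N by apply/card_gt0P; exists 0; apply: mem0_blocks.
rewrite -{1}card_blocks natrD addrK natrM mulfK // natr1 prednK //.
Qed.

Lemma prime_class_orbit (a b : 'Z_q) : e = p.-1 ->
  p%:R * a = 0 -> a != 0 -> p%:R * b = 0 -> b != 0 ->
  exists2 h, h \in H & b = chi h * a.
Proof.
move=> eE pa a0 pb b0; pose P := [set x : 'Z_q | (p%:R * x == 0) && (x != 0)].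
suff E : rel_orbit a = P.
  by have /imsetP : b \in rel_orbit a by rewrite E inE pb eqxx.
apply/eqP; rewrite eqEcard card_in_imset; last exact: rel_orbit_inj.
apply/andP; split.
  apply/fintype.subsetP => x /imsetP[h hH ->]; rewrite inE mulrCA pa mulr0 eqxx /=.
  by rewrite -(mulr0 (chi h)) (inj_eq (mulrI (cycl_char_unit h))).
rewrite eE -ltnS prednK ?prime_gt0 // -[X in (_ < X)%N](card_class 0) mulr0.
rewrite [X in (_ < X)%N](cardD1 0) inE mulr0 eqxx add1n ltnS subset_leq_card //.
by apply/fintype.subsetP => x; rewrite !inE andbC.
Qed.

(** [H] is transitive on the [p - 1] nonzero residues killed by [p], so [f] takes one value [v]
    there. Up to the integer [k0], [f 0] differs from [v] by [y0], at most 1/2 in size; the shift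
    [v + y0 / p] is the mean of these [p] values and leaves squares of sum [y0 ^+ 2 * (1 - 1 / p)].
    This replaces the generic share [p / 12]. *)
Lemma covering_full (x : K) : e = p.-1 -> exists2 y : K, ring_of_integers y &
  abs_norm (x - y) ^+ 2 <=
  (q%:R * ((q%:R - p%:R) / 12 + (1 - p%:R^-1) / 4) / e%:R / n%:R) ^+ n.
Proof.
move=> eE; have [g xE] := rat_coeffs (phi x).
pose f (a : 'Z_q) := g a - g (csec a).
have [xf fH] := coeffs_invariant (mem_embedded phi x) xE.
pose P : {pred 'Z_q} := [pred b : 'Z_q | p%:R * b != 0].
have [t [k' [kf le]]] := exists_shift_rounding P f.
have p0 : p%:R != 0 :> rat by rewrite pnatr_eq0 -lt0n prime_gt0.
have m_neq0 : m%:R != 0 :> 'Z_q by rewrite -zroot_eq1 zroot_class_neq1.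
have pm0 : p%:R * m%:R = 0 :> 'Z_q by rewrite -natrM -ppowE Zq_natr0.
pose v := f m%:R.
have fv b : p%:R * b = 0 -> b != 0 -> f b = v.
  by move=> pb b0; have [h hH ->] := prime_class_orbit eE pm0 m_neq0 pb b0; apply: fH.
pose k0 : int := Num.floor (f 0 - v + 1 / 2).
pose y0 : rat := f 0 - v - k0%:~R.
have y0le : y0 ^+ 2 <= 1 / 4.
  have := floor_itv (f 0 - v + 1 / 2); rewrite -/k0 intrD => /andP[l1 l2].
  have h1 : - (1 / 2) <= y0 by rewrite /y0; lra.
  have h2 : y0 <= 1 / 2 by rewrite /y0; lra.
  nra.
pose k (b : 'Z_q) : int := if p%:R * b == 0 then (if b == 0 then k0 else 0) else k' b.
pose s (b : 'Z_q) : rat := if p%:R * b == 0 then v + y0 / p%:R else t.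
have kH (h : gal_of {:L}) (a : 'Z_q) : h \in H -> k (chi h * a) = k a.
  move=> hH; rewrite /k mulrCA -{1 2}(mulr0 (chi h)).
  rewrite !(inj_eq (mulrI (cycl_char_unit h))).
  by case: ifP => // _; apply/kf/fH.
have sc a b : p%:R * a = p%:R * b -> s a = s b by rewrite /s => ->.
have [y iy ley] := covering_bound xf kH sc.
exists y => //; apply: le_trans ley _.
have card0 : #|[pred b : 'Z_q | p%:R * b == 0]| = p.
  by rewrite -[RHS](card_class 0) mulr0.
have cardP : #|P|%:R = q%:R - p%:R :> rat.
  have E := etrans (cardC [pred b : 'Z_q | p%:R * b == 0]) card_Zq.
  have -> : q%:R = (p + #|[predC [pred b : 'Z_q | p%:R * b == 0]]|)%:R :> rat.
    by rewrite -[X in (X + _)%N]card0 E.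
  by rewrite natrD addrC addKr; congr _%:R; apply: eq_card.
have lesum : \sum_a (f a - (k a)%:~R - s a) ^+ 2 <= (q%:R - p%:R) / 12 + (1 - p%:R^-1) / 4.
  rewrite (bigID P) /=; apply: lerD.
    rewrite -cardP; apply: le_trans le; rewrite le_eqVlt; apply/orP; left; apply/eqP.
    by apply: eq_bigr => a Pa; rewrite /k /s (negPf (Pa : p%:R * a != 0)).
  rewrite (bigD1 0) /=; last first.
    by apply/negP => /negP; rewrite mulr0 eqxx.
  rewrite (eq_bigr (fun=> (y0 / p%:R) ^+ 2)) => [|a]; last first.
    rewrite negbK => /andP[/eqP pa a0]; rewrite fv // /k /s pa eqxx (negPf a0).
    by rewrite subr0 opprD addrA subrr add0r sqrrN.
  rewrite (eq_bigl [in [set b : 'Z_q | (p%:R * b == 0) && (b != 0)]]); last first.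
    by move=> a; rewrite inE negbK.
  rewrite sumr_const.
  have -> : #|[set b : 'Z_q | (p%:R * b == 0) && (b != 0)]| = p.-1.
    apply: succn_inj; rewrite prednK ?prime_gt0 // -[RHS]card0 [RHS](cardD1 0).
    rewrite inE mulr0 eqxx add1n; congr _.+1; apply: eq_card => b.
    by rewrite !inE andbC.
  have -> : f 0 - (k 0)%:~R - s 0 = y0 * (1 - p%:R^-1).
    by rewrite /k /s mulr0 !eqxx /y0; field.
  have pE : p.-1%:R = p%:R - 1 :> rat.
    by rewrite -[in RHS](prednK (prime_gt0 p_pr)) -natr1 addrK.
  rewrite -[X in _ + X <= _]mulr_natl pE.
  have -> : (y0 * (1 - p%:R^-1)) ^+ 2 + (p%:R - 1) * (y0 / p%:R) ^+ 2
      = y0 ^+ 2 * (1 - p%:R^-1) by field.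
  have p1 : 0 <= 1 - p%:R^-1 :> rat.
    by rewrite subr_ge0 invf_le1 ?ltr0n ?ler1n ?prime_gt0.
  by apply: le_trans (ler_wpM2r p1 y0le) _; rewrite mulrC; lra.
have sum_ge0 : 0 <= \sum_a (f a - (k a)%:~R - s a) ^+ 2.
  by apply: sumr_ge0 => a _; rewrite sqr_ge0.
rewrite lerXn2r ?nnegrE ?mulr_ge0 ?invr_ge0 ?ler0n //.
  exact: le_trans lesum.
by rewrite !ler_wpM2r ?invr_ge0 ?ler0n // ler_wpM2l ?ler0n.
Qed.

End Subfield.

End CyclotomicField.

(** * The function omega *)

Section RealEstimates.

Variable R : realType.
Implicit Types x y : R.

Lemma ln_le_sqrt x : 0 < x -> ln x <= 2 * Num.sqrt x.
Proof.
move=> x_gt0; have s_gt0 : 0 < Num.sqrt x by rewrite sqrtr_gt0.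
rewrite -{1}(sqr_sqrtr (ltW x_gt0)) lnXn // -[leLHS]mulr_natl ler_wpM2l //.
have := @le_ln1Dx R (Num.sqrt x - 1).
have -> : 1 + (Num.sqrt x - 1) = Num.sqrt x by rewrite addrC subrK.
by move=> le; apply: le_trans (le _) _; lra.
Qed.

Lemma expR_le_inv1B y : y < 1 -> expR y <= (1 - y)^-1.
Proof.
move=> y1; have y0 : 0 < 1 - y by rewrite subr_gt0.
rewrite -[expR y]invrK -expRN lef_pV2 ?posrE ?expR_gt0 //.
exact: expR_ge1Dx.
Qed.

(** With [t = 1 / sqrt p], the bound [ln p <= 2 sqrt p] makes the exponent of [expR] at most
    [4 C t], so the product is at most the inverse of [(1 - t) (1 - 4 C t)]. *)
Lemma powR_pred_near1 (C eps : R) : 0 <= C -> 0 < eps -> exists N : nat,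
  forall p : nat, (N < p)%N ->
    p%:R / (p%:R - 1) * p%:R `^ (C / (p%:R - 1)) <= 1 + eps.
Proof.
(* [A] is such that [A * t < 1] means [(1 + 4 C) t < eps / (1 + eps)], and [1 - eps / (1 + eps)] is
   the inverse of [1 + eps]. *)
move=> C0 e0; pose A := (1 + 4 * C) * (1 + eps) / eps.
have A0 : 0 < A by rewrite !mulr_gt0 ?invr_gt0 // ?ltr_wpDr // ?mulr_ge0 // ltW.
exists (maxn 2 (Num.bound (A ^+ 2))) => p; rewrite gtn_max => /andP[p2 pN].
have P2 : 2 < p%:R :> R by rewrite (ltr_nat R 2).
have pA : A ^+ 2 < p%:R.
  by apply: lt_trans (archi_boundP _) _; rewrite ?ltr_nat ?exprn_ge0 // ltW.
set P : R := p%:R in P2 pA *; have P0 : 0 < P by lra.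
pose t := (Num.sqrt P)^-1; have s_gt0 : 0 < Num.sqrt P by rewrite sqrtr_gt0.
have t0 : 0 < t by rewrite invr_gt0.
have tt : t ^+ 2 = P^-1 by rewrite exprVn sqr_sqrtr // ltW.
have At : A * t < 1.
  rewrite ltr_pdivrMr // mul1r -(@ltr_pXn2r _ 2) ?nnegrE ?ltW //.
  by rewrite sqr_sqrtr // ltW.
have t1 : (1 + 4 * C) * t < eps / (1 + eps).
  rewrite ltr_pdivlMr; last by lra.
  by move: At; rewrite /A mulrAC ltr_pdivrMr // mul1r mulrAC.
have Ct : 0 <= C * t by rewrite mulr_ge0 // ltW.
have e1 : eps / (1 + eps) < 1 by rewrite ltr_pdivrMr ?mul1r; lra.
have t_lt1 : t + 4 * (C * t) < 1.
  by apply: lt_trans e1; move: t1; rewrite mulrDl mul1r -mulrA.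
have PV : P^-1 <= t by rewrite -tt expr2 ger_pMl //; lra.
pose y := C / (P - 1) * ln P.
have yle : y <= 4 * (C * t).
  have h1 : (P - 1)^-1 <= 2 / P.
    by rewrite -[2 / P]invf_div lef_pV2 ?posrE ?divr_gt0 //; lra.
  have lnP : ln P <= 2 * (P * t).
    have -> : P * t = Num.sqrt P.
      by rewrite -{1}(sqr_sqrtr (ltW P0)) expr2 mulfK // gt_eqF.
    exact: ln_le_sqrt.
  have lnP0 : 0 <= ln P by rewrite ln_ge0 //; lra.
  apply: (@le_trans _ _ (C * (2 / P) * (2 * (P * t)))).
    apply: ler_pM => //; last by apply: ler_wpM2l.
    by rewrite mulr_ge0 // invr_ge0; lra.
  by rewrite le_eqVlt; apply/orP; left; apply/eqP; field; rewrite gt_eqF.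
have -> : P `^ (C / (P - 1)) = expR y.
  by rewrite /powR gt_eqF.
have yy : y < 1 by lra.
have -> : P / (P - 1) = (1 - P^-1)^-1.
  by field; rewrite !gt_eqF //; lra.
apply: (@le_trans _ _ ((1 - t)^-1 * (1 - 4 * (C * t))^-1)).
  apply: ler_pM; rewrite ?invr_ge0 ?expR_ge0 //; first by lra.
    by rewrite lef_pV2 ?posrE; lra.
  apply: le_trans (expR_le_inv1B yy) _.
  by rewrite lef_pV2 ?posrE; lra.
rewrite -invfM.
have h : 1 - eps / (1 + eps) <= (1 - t) * (1 - 4 * (C * t)).
  have : 0 <= t * (4 * (C * t)) by rewrite !mulr_ge0 // ltW.
  move: t1; rewrite mulrDl mul1r -mulrA; set X := eps / (1 + eps); nra.
have e2 : 1 - eps / (1 + eps) = (1 + eps)^-1 by field; rewrite gt_eqF; lra.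
rewrite -[leRHS]invrK -e2 lef_pV2 ?posrE //; last by rewrite subr_gt0.
by apply: lt_le_trans h; rewrite subr_gt0.
Qed.

Lemma powR_le_root (a b x : R) (k : nat) : 0 <= a -> 0 <= b -> (0 < k)%N ->
  a `^ (x * k%:R) <= b ^+ k -> a `^ x <= b.
Proof.
move=> a0 b0 k0; rewrite powRrM powR_mulrn ?powR_ge0 //.
by rewrite ler_pXn2r ?nnegrE ?powR_ge0.
Qed.

End RealEstimates.

(** * Passage to abstract fields of odd prime power conductor *)

(** The conductor supplies a bare [fieldExtType], and the Galois arguments need a splitting field.
    An equality of structures, not an isomorphism, allows the replacement by [subst]. *)
Lemma cyclotomic_splittingFieldType (L : fieldExtType rat) (z : L) (q : nat) :
  q.-primitive_root z -> <<1; z>>%VS = {:L}%VS ->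
  exists Ls : splittingFieldType rat, L = Ls :> fieldExtType rat.
Proof.
move=> pz gz; have ax := cyclotomic_splitting_axiom pz gz; move: z pz gz ax => _ _ _ ax.
exists (HB.pack_for (splittingFieldType rat) (FieldExt.sort L)
  (FieldExt_isSplittingField.Build rat L ax)).
by destruct L as [T c]; destruct c.
Qed.

Lemma cyclotomic_subfield_struct (K L : fieldExtType rat) (z : L) (p r : nat)
    (phi : 'AHom(K, L)) :
  prime p -> odd p -> (0 < r)%N -> (p ^ r).-primitive_root z -> <<1; z>>%VS = {:L}%VS ->
  ((1 < r)%N -> ~ embeds_in_cyclotomic K (p ^ r.-1)) ->
  exists e B : nat,
  [/\ (e * \dim {:K} = totient (p ^ r))%N,
      ~~ (p %| e)%N,
      B%:R = ((p ^ r.-1)%:R - 1) / e%:R + 1 :> rat,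
      abs_disc K = (p ^ r)%:R ^+ \dim {:K} / p%:R ^+ B
    & forall x : K,
      (exists2 y : K, ring_of_integers y &
         abs_norm (x - y) ^+ 2 <=
         ((p ^ r)%:R ^+ 2 / (12 * e%:R * (\dim {:K})%:R)) ^+ \dim {:K}) /\
      (e = p.-1 -> exists2 y : K, ring_of_integers y &
         abs_norm (x - y) ^+ 2 <=
         ((p ^ r)%:R * (((p ^ r)%:R - p%:R) / 12 + (1 - p%:R^-1) / 4) / e%:R /
           (\dim {:K})%:R) ^+ \dim {:K})].
Proof.
move=> p_pr p_odd r_gt0 pz gz nemb.
have [Ls LE] := cyclotomic_splittingFieldType pz gz; subst L.
have dim_e := card_gal_relative_dim pz gz phi.
set e := #|_| in dim_e.
have npe : ~~ (p %| e)%N.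
  (* For [r = 1], [e] divides [p - 1]; for larger [r], an element of order [p] in [H] would push [K]
     into a smaller cyclotomic field. *)
  apply/negP => pe; have [r1|r1] := leqP r 1.
    have r1E : r = 1%N by apply/eqP; rewrite eqn_leq r1.
    have : (p %| totient (p ^ r))%N by rewrite -dim_e dvdn_mulr.
    rewrite r1E expn1 totient_prime //; move/dvdn_leq; case: (p) p_pr => [|[|k]] // _.
    by move/(_ isT); rewrite ltnn.
  apply: (nemb r1); apply: (descent_embeds p_pr r_gt0 pz r1).
  exact: (relative_descent p_pr r_gt0 pz gz p_odd pe).
have [c chic] := conj_zroot_ex p_pr r_gt0 pz.
have [iota] := cyclotomic_iota pz gz.
exists e, #|blocks p_pr r_gt0 pz phi|; split=> //.
- exact: card_blocks_rat.
- exact: (abs_disc_embedded gz npe chic).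
- move=> x; split; first exact: (covering_general gz npe chic iota).
  exact: (covering_full gz npe chic iota).
Qed.

Lemma opp_field_conductor (K : odd_prime_power_field) :
  [/\ prime (p_ K), odd (p_ K), (0 < r_ K)%N & is_conductor K (p_ K ^ r_ K)].
Proof.
have [p [r [p_pr p_odd r_gt0 cE]]] := opp_conductor K.
have pE : p_ K = p by rewrite /p_ cE -(prednK r_gt0) pdiv_pfactor.
have rE : r_ K = r by rewrite /r_ pE cE pfactorK.
rewrite pE rE; split=> //; move: cE; rewrite /conductor.
case: xgetP => [f -> cf <- //|_ E].
by have := expn_gt0 p r; rewrite -E (prime_gt0 p_pr).
Qed.

Lemma opp_field_struct (K : odd_prime_power_field) :
  exists e B : nat,
  [/\ (e * n_ K = totient (p_ K ^ r_ K))%N,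
      ~~ (p_ K %| e)%N,
      B%:R = ((p_ K ^ (r_ K).-1)%:R - 1) / e%:R + 1 :> rat,
      D_ K = (p_ K ^ r_ K)%:R ^+ n_ K / (p_ K)%:R ^+ B
    & forall x : K,
      (exists2 y : K, ring_of_integers y &
         abs_norm (x - y) ^+ 2 <=
         ((p_ K ^ r_ K)%:R ^+ 2 / (12 * e%:R * (n_ K)%:R)) ^+ n_ K) /\
      (e = (p_ K).-1 -> exists2 y : K, ring_of_integers y &
         abs_norm (x - y) ^+ 2 <=
         ((p_ K ^ r_ K)%:R *
           (((p_ K ^ r_ K)%:R - (p_ K)%:R) / 12 + (1 - (p_ K)%:R^-1) / 4) /
           e%:R / (n_ K)%:R) ^+ n_ K)].
Proof.
have [p_pr p_odd r_gt0 [_ [L [z pz gz] [phi]] cmin]] := opp_field_conductor K.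
apply: (cyclotomic_subfield_struct phi p_pr p_odd r_gt0 pz gz) => r_gt1 emb.
have := cmin _ _ emb; rewrite expn_gt0 prime_gt0 // => /(_ isT).
by rewrite leq_exp2l ?prime_gt1 // leqNgt prednK // leqnn.
Qed.

Lemma opp_field_rel_degree (K : odd_prime_power_field) (e0 : nat) :
  r_ K = 1%N -> cyclotomic_degree_over K (p_ K) e0 -> (e0 * n_ K = (p_ K).-1)%N.
Proof.
move=> r1 [L [z pz gz] [phi <-]].
have [p_pr _ _ _] := opp_field_conductor K.
have [Ls LE] := cyclotomic_splittingFieldType pz gz; subst L.
rewrite -totient_prime // /n_ -(dim_embedded phi) divnK ?field_dimS ?subvf //.
have pz1 : (p_ K ^ 1).-primitive_root z by rewrite expn1.
by rewrite (dim_cyclotomic pz1 gz) expn1.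
Qed.

(** As [e] is prime to [p] and [e n = (p - 1) p^(r - 1)], [e] divides [p - 1]. *)
Lemma pred_ppow_le_dim (K : odd_prime_power_field) : (p_ K ^ (r_ K).-1 <= n_ K)%N.
Proof.
have [p_pr p_odd r_gt0 _] := opp_field_conductor K.
have [e [B [en npe _ _ _]]] := opp_field_struct K.
have e_dvd : (e %| (p_ K).-1)%N.
  rewrite -(@Gauss_dvdl _ _ (p_ K ^ (r_ K).-1)) -?totient_pfactor // -?en ?dvdn_mulr //.
  by rewrite coprime_sym coprimeXl // prime_coprime.
have p1 : (0 < (p_ K).-1)%N by rewrite -ltnS prednK ?prime_gt0 ?prime_gt1.
have e0 := dvdn_gt0 p1 e_dvd.
rewrite -(leq_pmul2l e0) en totient_pfactor // leq_mul2r dvdn_leq // orbT //.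
Qed.

Section Omega.

Variable R : realType.
Implicit Type K : odd_prime_power_field.

(** * The upper bound in terms of omega *)

Lemma euclidean_minimum_le (K : fieldExtType rat) (b : R) :
  (forall x : K, exists2 y, ring_of_integers y & ratr (abs_norm (x - y)) <= b) ->
  (euclidean_minimum K R <= b%:E)%E.
Proof.
move=> le; apply: ge_ereal_sup => _ [x _ <-]; have [y iy ley] := le x.
apply: (@le_trans _ _ (ratr (abs_norm (x - y)))%:E); last by rewrite lee_fin.
by apply: ereal_inf_lbound; exists y.
Qed.

(* [D_ K = p ^ (r * n) / p ^ (n * disc_exponent K)]. *)
Definition disc_exponent K : R :=
  ((p_ K ^ (r_ K).-1)%:R - 1) / (totient (p_ K ^ r_ K))%:R + (n_ K)%:R^-1.

Definition omega_square K : R :=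
  (p_ K)%:R / (12 * ((p_ K)%:R - 1)) * (p_ K)%:R `^ disc_exponent K.

(* The generic bound would violate (iii) for this field alone; there the residues
   killed by [p] form one nonzero orbit and are rounded apart from the others. *)
Definition is_cubic9 K := [&& p_ K == 3%N, r_ K == 2%N & n_ K == 3%N].

Definition omega K : R :=
  if is_cubic9 K then 3 `^ (- (2 / 3)) else Num.sqrt (omega_square K).

Lemma n_gt0 K : (0 < n_ K)%N.
Proof. by rewrite /n_ adim_gt0. Qed.

Lemma p_ge3 K : (3 <= p_ K)%N.
Proof. by have [p_pr p_odd _ _] := opp_field_conductor K; apply: odd_prime_gt2. Qed.

Lemma p_ge3R K : 3 <= (p_ K)%:R :> R.
Proof. by rewrite (ler_nat R 3) p_ge3. Qed.

Lemma omega_square_ge0 K : 0 <= omega_square K.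
Proof.
have p3 := p_ge3R K.
by rewrite !mulr_ge0 ?powR_ge0 ?invr_ge0 ?mulr_ge0 ?ler0n // subr_ge0; lra.
Qed.

Lemma omega_ge0 K : 0 <= omega K.
Proof. by rewrite /omega; case: ifP; rewrite ?powR_ge0 ?sqrtr_ge0. Qed.

Lemma totientR K : (totient (p_ K ^ r_ K))%:R =
  ((p_ K)%:R - 1) * (p_ K ^ (r_ K).-1)%:R :> R.
Proof.
have [p_pr _ r_gt0 _] := opp_field_conductor K.
rewrite totient_pfactor // natrM -subn1 natrB // prime_gt0 //.
Qed.

Lemma ppow_gt0R K k : 0 < (p_ K ^ k)%:R :> R.
Proof. by rewrite ltr0n expn_gt0 (leq_trans _ (p_ge3 K)). Qed.

Lemma sqr_pow3 : (3 `^ (- (2 / 3)) : R) ^+ 2 = (3 `^ (4 / 3))^-1.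
Proof. by rewrite -powR_mulrn ?powR_ge0 // -powRrM -powRN; congr (_ `^ _); field. Qed.

Lemma pow3_43_cube : ((3 : R) `^ (4 / 3)) ^+ 3 = 81.
Proof.
rewrite -powR_mulrn ?powR_ge0 // -powRrM.
have -> : 4 / 3 * 3%:R = 4%:R :> R by field.
by rewrite powR_mulrn ?ler0n //; ring.
Qed.

Lemma euclidean_minimum_omega K :
  (euclidean_minimum K R <= (omega K ^+ n_ K * Num.sqrt (ratr (D_ K)))%:E)%E.
Proof.
have [p_pr p_odd r_gt0 _] := opp_field_conductor K.
have [e [B [en npe BE DE cov]]] := opp_field_struct K.
have p3 := p_ge3R K; have n0 := n_gt0 K.
have nR : 0 < (n_ K)%:R :> R by rewrite ltr0n.
have m0 := ppow_gt0R K (r_ K).-1.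
have enR : e%:R * (n_ K)%:R = ((p_ K)%:R - 1) * (p_ K ^ (r_ K).-1)%:R :> R.
  by rewrite -natrM en totientR.
have eR : 0 < e%:R :> R.
  rewrite ltr0n lt0n; apply: contraNneq npe => ->.
  exact: dvdn0.
have DR : ratr (D_ K) = (p_ K ^ r_ K)%:R ^+ n_ K / (p_ K)%:R ^+ B :> R.
  by rewrite DE fmorph_div !rmorphXn /= !ratr_nat.
have qE : (p_ K ^ r_ K)%:R = (p_ K)%:R * (p_ K ^ (r_ K).-1)%:R :> R.
  by rewrite -natrM -expnS prednK.
have D0 : 0 <= ratr (D_ K) :> R by rewrite DR divr_ge0 ?exprn_ge0 ?ler0n.
apply: euclidean_minimum_le => x.
suff [y iy le] : exists2 y : K, ring_of_integers y &
    ratr (abs_norm (x - y)) ^+ 2 <= (omega K ^+ 2) ^+ n_ K * ratr (D_ K) :> R.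
  have w0 : 0 <= omega K ^+ n_ K * Num.sqrt (ratr (D_ K)).
    by rewrite mulr_ge0 ?exprn_ge0 ?omega_ge0 ?sqrtr_ge0.
  exists y => //; rewrite -(@ler_pXn2r _ 2) ?nnegrE ?ler0q ?normr_ge0 //.
  by rewrite [leRHS]exprMn sqr_sqrtr // exprAC.
(* Here [e = p - 1 = 2] and [B = 2], so the discriminant is 81; the refined covering bound is 1, and
   so is the right-hand side. *)
have [/and3P[/eqP pE /eqP rE /eqP nE]|cub] := boolP (is_cubic9 K).
  have eE : e = 2%N by move: en; rewrite pE rE nE totient_pfactor //=; lia.
  have [_ /(_ _)[|y iy le]] := cov x; first by rewrite eE pE.
  exists y => //; rewrite /omega ifT; last by rewrite /is_cubic9 pE rE nE.
  rewrite sqr_pow3 exprVn nE pow3_43_cube DR pE rE nE.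
  have BE2 : B = 2%N.
    apply/eqP; rewrite -(eqr_nat rat) BE pE rE eE /= expn1.
    by have -> : (3 - 1) / 2 + 1 = 2 :> rat by field.
  move: le; rewrite -(ler_rat R) rmorphXn /= => /le_trans; apply.
  rewrite BE2 eE pE rE nE !natrX.
  have -> : (3 ^+ 2 * ((3 ^+ 2 - 3) / 12 + (1 - 3^-1) / 4) / 2 / 3) ^+ 3 = 1 :> rat by field.
  by rewrite rmorph1; clear; lra.
have [[y iy le] _] := cov x; exists y => //.
rewrite /omega (negPf cub) sqr_sqrtr ?omega_square_ge0 //.
move: le; rewrite -(ler_rat R) rmorphXn /= => /le_trans; apply.
rewrite DR rmorphXn fmorph_div rmorphXn !rmorphM /= !ratr_nat.
have BR : disc_exponent K * (n_ K)%:R = B%:R.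
  have /(congr1 (ratr : rat -> R)) := BE.
  rewrite rmorphD fmorph_div rmorphB rmorph1 /= !ratr_nat => ->.
  rewrite /disc_exponent totientR -enR.
  move: (p_ K ^ _)%:R e%:R eR (n_ K)%:R nR => M E E0 n' n'0.
  by field; rewrite !gt_eqF.
have XE : omega_square K ^+ n_ K =
    ((p_ K)%:R / (12 * ((p_ K)%:R - 1))) ^+ n_ K * (p_ K)%:R ^+ B.
  rewrite exprMn; congr (_ * _).
  by rewrite -powR_mulrn ?powR_ge0 // -powRrM BR powR_mulrn ?ler0n.
have pB : (p_ K)%:R ^+ B != 0 :> R by rewrite expf_neq0 // pnatr_eq0 -lt0n prime_gt0.
(* The factor [p ^ B] cancels against the discriminant. What is left is an equality:
   [p q / (12 (p - 1)) = q^2 / (12 e n)], from [e n = (p - 1) m] and [q = p m]. *)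
rewrite XE -[leRHS]mulrA [_ ^+ B * _]mulrC divfK // -[leRHS]exprMn.
rewrite le_eqVlt; apply/orP; left; apply/eqP; congr (_ ^+ _).
rewrite -mulrA enR qE.
move: (p_ K ^ _)%:R m0 (p_ K)%:R p3 => M M0 P P3; field; clear -M0 P3.
by rewrite !gt_eqF //; lra.
Qed.

(** * Limits of omega and the bound for non-squarefree conductors *)

Lemma disc_exponent_ge0 K : 0 <= disc_exponent K.
Proof.
rewrite addr_ge0 ?invr_ge0 ?ler0n // divr_ge0 ?ler0n // subr_ge0 ler1n.
by rewrite expn_gt0 (leq_trans _ (p_ge3 K)).
Qed.

Lemma disc_exponent_le K (u : R := (p_ K ^ (r_ K).-1)%:R^-1) :
  disc_exponent K <= (1 - u) / ((p_ K)%:R - 1) + u.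
Proof.
have p3 := p_ge3R K; have m0 := ppow_gt0R K (r_ K).-1.
apply: lerD; last first.
  by rewrite /u lef_pV2 ?posrE ?ltr0n ?n_gt0 // ?ler_nat ?pred_ppow_le_dim // -(ltr0n R).
rewrite le_eqVlt; apply/orP; left; apply/eqP; rewrite totientR /u.
move: (p_ K ^ _)%:R m0 (p_ K)%:R p3 => M M0 P P3; field.
by rewrite !gt_eqF //; lra.
Qed.

(** The bound [(1 - u) / (p - 1) + u] increases with [u], and [u <= 1 / p] when [r >= 2]; its value
    at [1 / p] is [2 / p]. *)
Lemma disc_exponent_le_div K : (2 <= r_ K)%N -> disc_exponent K <= 2 / (p_ K)%:R.
Proof.
move=> r2; have p3 := p_ge3R K; apply: le_trans (disc_exponent_le K) _.
set u := _^-1; set P : R := (p_ K)%:R in p3 *.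
have uP : u <= P^-1.
  have P0 : 0 < P by lra.
  rewrite /u lef_pV2 ?posrE ?ppow_gt0R // ler_nat -{1}(expn1 (p_ K)) leq_exp2l;
    last exact: leq_trans (p_ge3 K).
  by rewrite -ltnS prednK // ltnW.
have P1 : (P - 1)^-1 <= 1 by rewrite invf_le1; lra.
have -> : 2 / P = (1 - P^-1) / (P - 1) + P^-1 by field; rewrite !gt_eqF; lra.
rewrite -subr_ge0.
have -> : (1 - P^-1) / (P - 1) + P^-1 - ((1 - u) / (P - 1) + u) =
  (P^-1 - u) * (1 - (P - 1)^-1) by ring.
by rewrite mulr_ge0 // subr_ge0.
Qed.

Lemma sqr_invsqrt12 : (1 / (2 * Num.sqrt 3) : R) ^+ 2 = 12^-1.
Proof.
rewrite div1r exprVn exprMn sqr_sqrtr ?ler0n //; congr (_^-1); ring.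
Qed.

Lemma invsqrt12_ge0 : 0 <= 1 / (2 * Num.sqrt 3) :> R.
Proof. by rewrite divr_ge0 ?mulr_ge0 ?sqrtr_ge0 ?ler0n. Qed.

(** Common to both limits: [C = 2] serves for [r >= 2], and [C = e0] for [r = 1], where the exponent
    equals [1 / n = e0 / (p - 1)]. *)
Lemma omega_near (C eps : R) : 0 <= C -> 0 < eps -> exists N : nat,
  forall K, disc_exponent K <= C / ((p_ K)%:R - 1) -> (N < p_ K)%N ->
    `|omega K - 1 / (2 * Num.sqrt 3)| < eps.
Proof.
move=> C0 e0; have [N near1] := powR_pred_near1 C0 e0.
(* Taking [p > 3] leaves out the exceptional cubic field. *)
exists (maxn 3 N) => K bK; rewrite gtn_max => /andP[p3 /near1 {}near1].
have P3 : 3 < (p_ K)%:R :> R by rewrite (ltr_nat R 3).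
set w0 := 1 / _; have w0_ge0 : 0 <= w0 := invsqrt12_ge0.
have w02 : w0 ^+ 2 = 12^-1 := sqr_invsqrt12.
have wK : omega K ^+ 2 = omega_square K.
  by rewrite /omega /is_cubic9 gtn_eqF //= sqr_sqrtr ?omega_square_ge0.
have w_ge0 := omega_ge0 K.
pose X := (p_ K)%:R / ((p_ K)%:R - 1) * (p_ K)%:R `^ disc_exponent K.
have XE : omega K ^+ 2 = w0 ^+ 2 * X.
  by rewrite wK w02 /X /omega_square; field; rewrite gt_eqF //; lra.
have f1 : 1 <= (p_ K)%:R / ((p_ K)%:R - 1) :> R by rewrite ler_pdivlMr; lra.
have X1 : 1 <= X.
  apply: mulr_ege1 => //; rewrite -[leLHS](powRr0 (p_ K)%:R).
  by apply: ler_powR; [lra | exact: disc_exponent_ge0].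
have X2 : X <= 1 + eps.
  apply: le_trans near1; apply: ler_wpM2l; first by lra.
  by apply: ler_powR => //; lra.
have lo : w0 <= omega K.
  by rewrite -(@ler_pXn2r _ 2) ?nnegrE // XE ler_peMr ?sqr_ge0.
have hi : omega K <= w0 * (1 + eps).
  rewrite -(@ler_pXn2r _ 2) ?nnegrE ?mulr_ge0 //; last by lra.
  rewrite XE [leRHS]exprMn ler_wpM2l ?sqr_ge0 //; clear -X2 e0; nra.
have w1 : w0 < 1 by rewrite -(@ltr_pXn2r _ 2) ?nnegrE ?ler01 // w02; lra.
rewrite ger0_norm ?subr_ge0 //; nra.
Qed.

Lemma omega_lim_ramified :
  lim_p_infty (fun K => (2 <= r_ K)%N) omega (1 / (2 * Num.sqrt 3)).
Proof.
move=> eps e0; have [|N near] := @omega_near 2 eps _ e0; first by rewrite ler0n.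
exists N => K r2 pN; apply: near => //; have p3 := p_ge3R K.
apply: le_trans (disc_exponent_le_div r2) _.
rewrite ler_wpM2l ?ler0n // lef_pV2 ?posrE; lra.
Qed.

Lemma omega_lim_prime (e0 : nat) :
  lim_p_infty (fun K => r_ K = 1%N /\ cyclotomic_degree_over K (p_ K) e0)
    omega (1 / (2 * Num.sqrt 3)).
Proof.
move=> eps eps0; have [|N near] := @omega_near e0%:R eps _ eps0; first by rewrite ler0n.
exists N => K [r1 deg] pN; apply: near => //; have p3 := p_ge3R K.
have en := opp_field_rel_degree r1 deg.
have enR : e0%:R * (n_ K)%:R = (p_ K)%:R - 1 :> R.
  by rewrite -natrM en -subn1 natrB // (leq_trans _ (p_ge3 K)).
have nR : 0 < (n_ K)%:R :> R by rewrite ltr0n n_gt0.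
have e0R : e0%:R != 0 :> R.
  by apply/negP => /eqP E; move: enR; rewrite E mul0r; lra.
rewrite /disc_exponent r1 expn0 subrr mul0r add0r -enR le_eqVlt; apply/orP; left.
by apply/eqP; field; rewrite e0R gt_eqF.
Qed.

Lemma leq_sqr_exp2 (k : nat) : (4 <= k)%N -> (k ^ 2 <= 2 ^ k)%N.
Proof.
move=> k4; rewrite -(subnK k4); elim: (k - 4)%N => // j IH.
rewrite addSn [X in (_ <= X)%N]expnS; nia.
Qed.

Lemma omega_square_le K : (2 <= r_ K)%N -> ~~ is_cubic9 K ->
  omega_square K <= (3 `^ (4 / 3))^-1.
Proof.
move=> r2 cub; have [p_pr p_odd r_gt0 _] := opp_field_conductor K.
have c_gt0 : 0 < (3 : R) `^ (4 / 3) by rewrite powR_gt0.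
have := p_ge3 K; rewrite leq_eqVlt => /predU1P[pE|p4].
  (* For [p = 3] the exponent is at most [(1 + u) / 2], which is at most 5/9 when [r >= 3], as then
     [u <= 1/9]. For [r = 2], [e] divides 6 and is prime to 3, and [e = 2] is the excluded cubic
     field; so [n = 6], with exponent 1/2. *)
  have bK : disc_exponent K <= 5 / 9.
    have [r3|r3] := ltnP 2 (r_ K).
      apply: le_trans (disc_exponent_le K) _; set u := _^-1.
      have u9 : u <= 9^-1.
        rewrite lef_pV2 ?posrE ?ppow_gt0R // (ler_nat R 9) -pE (@leq_exp2l 3 2) //.
        by case: (r_ K) r3.
      move: u u9 => u u9; rewrite -pE (_ : 3 - 1 = 2 :> R); last by ring.
      by lra.
    have rE : r_ K = 2%N by apply/eqP; rewrite eqn_leq r3.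
    have [e [B [en npe _ _ _]]] := opp_field_struct K.
    have nE : n_ K = 6%N.
      have : (e \in divisors 6)%N.
        by rewrite -dvdn_divisors // -[6%N]/(totient (3 ^ 2)) pE -rE -en dvdn_mulr.
      move: en npe cub; rewrite /is_cubic9 -pE rE totient_pfactor //=.
      rewrite !inE => en npe cub /or4P[] /eqP eE; move: en npe cub; rewrite eE //=; lia.
    rewrite /disc_exponent nE rE totient_pfactor // -pE /= expn1.
    by clear; lra.
  (* [17/9 = 5/9 + 4/3], and 8 is [12 (p - 1) / p] at [p = 3]. The inequality is [3^17 <= 8^9],
     which is rather tight. *)
  have le8 : (3 : R) `^ (17 / 9) <= 8.
    apply: (@powR_le_root _ _ _ _ 9) => //.
    have -> : 17 / 9 * 9%:R = 17%:R :> R by field.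
    by rewrite powR_mulrn //; clear; lra.
  rewrite /omega_square -pE.
  rewrite -[leRHS]mul1r ler_pdivlMr //.
  have le59 : (3 : R) `^ disc_exponent K <= 3 `^ (5 / 9) by apply: ler_powR => //; lra.
  have E : (3 : R) `^ (5 / 9) * 3 `^ (4 / 3) = 3 `^ (17 / 9).
    by rewrite -powRD; [congr (_ `^ _); field | rewrite pnatr_eq0 implybT].
  have le83 : (3 : R) `^ disc_exponent K * 3 `^ (4 / 3) <= 8.
    by apply: le_trans le8; rewrite -E ler_wpM2r ?powR_ge0.
  rewrite (_ : 3 / (12 * (3 - 1)) = 8^-1 :> R); last by field.
  by rewrite -mulrA; lra.
have P5 : 5 <= (p_ K)%:R :> R.
  rewrite (ler_nat R 5) ltn_neqAle p4 andbT.
  by apply: contraTneq p_odd => <-.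
(* [p^(2 / p) <= 2] amounts to [p^2 <= 2^p], valid from 4 on. With the prefactor at most 5/48, the
   product is at most 5/24, and [81 <= (24/5)^3] concludes. *)
have le2 : (p_ K)%:R `^ disc_exponent K <= 2 :> R.
  apply: (@le_trans _ _ ((p_ K)%:R `^ (2 / (p_ K)%:R))).
    by apply: ler_powR; [lra | exact: disc_exponent_le_div].
  apply: (@powR_le_root _ _ _ _ (p_ K)); rewrite ?ler0n ?prime_gt0 //.
  rewrite divfK ?gt_eqF //; last by lra.
  by rewrite powR_mulrn ?ler0n // -!natrX ler_nat leq_sqr_exp2.
have c_le : (3 : R) `^ (4 / 3) <= 24 / 5.
  apply: (@powR_le_root _ _ _ _ 3) => //.
  by rewrite powRrM powR_mulrn ?powR_ge0 // pow3_43_cube; lra.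
apply: (@le_trans _ _ (5 / 24)); last first.
  by rewrite -invf_div lef_pV2 ?posrE //; lra.
have f5 : (p_ K)%:R / (12 * ((p_ K)%:R - 1)) <= 5 / 48 :> R.
  by rewrite ler_pdivrMr; lra.
apply: (@le_trans _ _ (5 / 48 * 2)); last by lra.
apply: ler_pM => //; rewrite ?powR_ge0 // divr_ge0 ?ler0n //; lra.
Qed.

Lemma omega_le K : (2 <= r_ K)%N -> omega K <= 3 `^ (- (2 / 3)).
Proof.
move=> r2; rewrite /omega; have [//|cub] := boolP (is_cubic9 K).
rewrite -(@ler_pXn2r _ 2) ?nnegrE ?sqrtr_ge0 ?powR_ge0 //.
by rewrite sqr_sqrtr ?omega_square_ge0 // sqr_pow3 omega_square_le.
Qed.

End Omega.

Local Open Scope classical_set_scope.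

Theorem theorem3p2 (R : realType) :
  exists omega : odd_prime_power_field -> R,
    [/\ (forall K : odd_prime_power_field,
           (euclidean_minimum K R
              <= (omega K ^+ n_ K * Num.sqrt (ratr (D_ K)))%:E)%E),
        lim_p_infty (fun K : odd_prime_power_field => (2 <= r_ K)%N)
          omega (1 / (2 * Num.sqrt 3)),
        (forall e0 : nat,
           lim_p_infty (fun K : odd_prime_power_field =>
               r_ K = 1%N /\ cyclotomic_degree_over K (p_ K) e0)
             omega (1 / (2 * Num.sqrt 3)))
      & (forall K : odd_prime_power_field,
           (2 <= r_ K)%N -> omega K <= 3 `^ (- (2 / 3)))].
Proof.
exists (@omega R); split.
- exact: euclidean_minimum_omega.
- exact: omega_lim_ramified.
- exact: omega_lim_prime.
- exact: omega_le.
Qed.
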